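(* Let $\Bbbk$ be a field of characteristic zero, $U$ a finite-dimensional $\Bbbk$-vector space, $W\subset\mathcal Z^2(U)$ a finite-dimensional graded submodule, $\mathfrak g_W=M(U)/W^\perp$, and $V=\mathfrak g_W/\gamma_2(\mathfrak g_W)\simeq U$. For $r\ge0$, $u_1,\dots,u_r,v,w\in V$, choose lifts to $\mathfrak g_W$ and set $$T^{(r)}_{\mathfrak g_W}\bigl(u_1\cdots u_r\otimes(v\wedge w)\bigr)=\operatorname{ad}_{u_r}\cdots\operatorname{ad}_{u_1}[v,w]\pmod{\gamma_{r+3}(\mathfrak g_W)}.$$ Then every $T^{(r)}_{\mathfrak g_W}:\operatorname{Sym}^rV\otimes\Lambda^2V\to\gamma_{r+2}(\mathfrak g_W)/\gamma_{r+3}(\mathfrak g_W)$ is well defined and symmetric in its outer entries $u_1,\dots,u_r$. Under $V\simeq U$, $$\operatorname{im}\bigl((T^{(r)}_{\mathfrak g_W})^*\bigr)=W_r\subset\operatorname{Sym}^rU^*\otimes\Lambda^2U^*\qquad(r\ge0).$$ Consequently the full tuple of lower-central tensors $(T^{(r)}_{\mathfrak g_W})_{r\ge0}$ recovers $W$. If $W\ne0$ and $d=\max\{r:W_r\neq0\}$, then in particular the terminal tensor $T_{\mathfrak g_W}:=T^{(d)}_{\mathfrak g_W}:\operatorname{Sym}^dV\otimes\Lambda^2V\to\gamma_{d+2}(\mathfrak g_W)$ (here $\gamma_{d+3}(\mathfrak g_W)=0$) satisfies $\operatorname{im}(T_{\mathfrak g_W}^* )=W_d$.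
   Context: $R=\operatorname{Sym}(U)$. $M(U)=\operatorname{Lie}(U)/\operatorname{Lie}(U)''$ is the free metabelian Lie algebra; $B(U)=M(U)'$ is an abelian ideal and a graded $R$-module via $u\cdot b=[u,b]$, with $[u,v]$ ($u,v\in U$) in internal degree $0$; internal degree $r$ is Lie degree $r+2$. $\mathcal Z^2(U)=B(U)^\circ=\bigoplus_r B(U)_r^*$ is the restricted graded dual, with contraction action $\langle b,p\circ\Phi\rangle=\langle pb,\Phi\rangle$ of $p\in R$. Dualizing the surjection $\operatorname{Sym}^rU\otimes\Lambda^2U\to B(U)_r$, $p\otimes(u\wedge v)\mapsto p\cdot[u,v]$, embeds $\mathcal Z^2(U)_r$ in $(\operatorname{Sym}^rU)^*\otimes\Lambda^2U^*$, written $\operatorname{Sym}^rU^*\otimes\Lambda^2U^*$ (divided powers and symmetric powers are identified in characteristic zero). Its image is the space of closed 2-forms, i.e. the kernel of $(\delta\Phi)(u,v,w)=u\circ\Phi(v,w)-v\circ\Phi(u,w)+w\circ\Phi(u,v)$. ''Graded submodule'' means graded subspace stable under contraction by $R$. $W_r$ is the degree-$r$ part of $W$, and $W^\perp\subset B(U)$ is the annihilator of $W$ (an $R$-submodule, hence an ideal of $M(U)$). $\gamma_j$ denotes the lower central series ($\gamma_1=\mathfrak g$). *)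

(* Defs.v *)
From HB Require Import structures.
From mathcomp Require Import all_boot all_order all_algebra.
From mathcomp Require Import boolp classical_sets functions.
From mathcomp Require Import freeg.

Set Implicit Arguments.
Unset Strict Implicit.
Unset Printing Implicit Defensive.

Import GRing.Theory.
Local Open Scope ring_scope.
Local Open Scope quotient_scope.
Local Open Scope classical_set_scope.

Section Submodules.
Variables (K : fieldType) (V : lmodType K).

Record is_submod (P : set V) : Prop := IsSubmod {
  is_submod0 : P 0;
  is_submodD : forall x y, P x -> P y -> P (x + y);
  is_submodZ : forall a x, P x -> P (a *: x) }.

Definition submod_pred (P : set V) (h : is_submod P) : V -> bool :=
  fun v => `[< P v >].

Fact submod_pred_closed P (h : is_submod P) :
  subsemimod_closed (submod_pred h).
Proof.
split; first split.
- by apply/asboolP; exact: (is_submod0 h).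
- by move=> x y /asboolP Px /asboolP Py; apply/asboolP; exact: (is_submodD h).
- by move=> a x /asboolP Px; apply/asboolP; exact: (is_submodZ h).
Qed.

HB.instance Definition _ P (h : is_submod P) :=
  GRing.isSubmodClosed.Build K V (submod_pred h) (submod_pred_closed h).

Definition submod_of P (h : is_submod P) : submodClosed V :=
  GRing.SubmodClosed.clone K V (submod_pred h) _.

Lemma submod_ofP P (h : is_submod P) x : x \in submod_of h <-> P x.
Proof. by split => /asboolP. Qed.

(* [submodClosed] only records closure under addition and scaling. *)
Lemma submodN (S : submodClosed V) x : x \in S -> - x \in S.
Proof. by move=> Sx; rewrite -scaleN1r rpredZ. Qed.

Lemma submodB (S : submodClosed V) x y : x \in S -> y \in S -> x - y \in S.
Proof. by move=> Sx Sy; rewrite rpredD ?submodN. Qed.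

Fact span_is_submod (X : set V) :
  is_submod [set v | forall S : submodClosed V,
                       (forall x, X x -> x \in S) -> v \in S].
Proof.
split=> [S _|x y hx hy S XS|a x hx S XS]; first exact: rpred0.
  by rewrite rpredD ?hx ?hy.
by rewrite rpredZ ?hx.
Qed.

Definition span (X : set V) : submodClosed V := submod_of (span_is_submod X).

Lemma mem_span (X : set V) x : X x -> x \in span X.
Proof. by move=> Xx; apply/submod_ofP => S; apply. Qed.

Lemma span_min (X : set V) (S : submodClosed V) :
  (forall x, X x -> x \in S) -> {subset span X <= S}.
Proof. by move=> h x /submod_ofP; apply. Qed.

Definition finite_dim (S : submodClosed V) : Prop :=
  exists s : seq V, S =i span [set x | x \in s].

Fact full_is_submod : is_submod [set: V].
Proof. by []. Qed.

End Submodules.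

Section Preimage.
Variables (K : fieldType) (V W : lmodType K) (f : {linear V -> W}).
Variable S : submodClosed W.

Fact preim_is_submod : is_submod [set x | f x \in S].
Proof.
split=> [|x y /= Sx Sy|a x /= Sx]; first by rewrite /= linear0 rpred0.
  by rewrite linearD rpredD.
by rewrite linearZ rpredZ.
Qed.

Definition preim_submod : submodClosed V := submod_of preim_is_submod.

End Preimage.

Lemma linear_span0 (K : fieldType) (V W : lmodType K) (f : V -> W) (X : set V) :
  linear f -> (forall x, X x -> f x = 0) ->
  forall x, x \in span X -> f x = 0.
Proof.
move=> lin_f fX.
have lin0 : f 0 = 0.
  by have := lin_f (- 1) 0 0; rewrite scaler0 addr0 scaleN1r addNr.
have ker : is_submod [set x | f x = 0].
  split=> //= [x y fx fy|a x fx].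
    by have := lin_f 1 x y; rewrite !scale1r fx fy addr0.
  by have := lin_f a x 0; rewrite addr0 fx lin0 scaler0 addr0.
move=> x /(@span_min _ _ X (submod_of ker)) h.
by apply/(submod_ofP ker)/h => y /fX; exact: (submod_ofP ker y).2.
Qed.

Section Subspaces.
Variables (K : fieldType) (V : lmodType K) (S : submodClosed V).

Definition subspace := {x : V | x \in S}.

HB.instance Definition _ := SubType.on subspace.
HB.instance Definition _ := Choice.on subspace.
HB.instance Definition _ := [SubChoice_isSubLmodule of subspace by <:].

Definition insubspace (x : V) (Sx : x \in S) : subspace := exist _ x Sx.

End Subspaces.

Section Quotients.
Variables (K : fieldType) (V : lmodType K) (S : submodClosed V).

Definition zmod_pred : V -> bool := fun x => x \in S.
Fact zmod_pred_closed : zmod_closed zmod_pred.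
Proof. by split; [exact: (@rpred0 _ S) | move=> x y; exact: submodB]. Qed.
HB.instance Definition _ := GRing.isZmodClosed.Build V zmod_pred
  zmod_pred_closed.

Definition quotient := Quotient.quot (Algebra.ZmodClosed.clone V zmod_pred _).
HB.instance Definition _ := GRing.Zmodule.on quotient.

Definition proj (x : V) : quotient := \pi x.

Lemma projK (q : quotient) : proj (repr q) = q.
Proof. exact: reprK. Qed.

Lemma proj_eq x y : proj x = proj y <-> x - y \in S.
Proof.
by rewrite (Quotient.idealrBE (Algebra.ZmodClosed.clone V zmod_pred _));
  split => /eqP.
Qed.

Lemma projD x y : proj (x + y) = proj x + proj y.
Proof. exact: raddfD. Qed.

Definition quotient_scale (a : K) (q : quotient) : quotient :=
  proj (a *: repr q).

Lemma proj_scale a x : proj (a *: x) = quotient_scale a (proj x).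
Proof.
apply/proj_eq; rewrite -scalerBr; apply: rpredZ.
by apply/proj_eq; rewrite projK.
Qed.

Fact quotient_scaleA a b q :
  quotient_scale a (quotient_scale b q) = quotient_scale (a * b) q.
Proof. by rewrite -[q]projK -!proj_scale scalerA. Qed.
Fact quotient_scale1 : left_id 1 quotient_scale.
Proof. by move=> q; rewrite -[q]projK -!proj_scale scale1r. Qed.
Fact quotient_scaleDr : right_distributive quotient_scale +%R.
Proof.
by move=> a q r; rewrite -[q]projK -[r]projK -projD -!proj_scale scalerDr projD.
Qed.
Fact quotient_scaleDl q : {morph quotient_scale^~ q : a b / a + b}.
Proof. by move=> a b; rewrite -[q]projK -!proj_scale scalerDl projD. Qed.

HB.instance Definition _ := GRing.Zmodule_isLmodule.Build K quotient
  quotient_scaleA quotient_scale1 quotient_scaleDr quotient_scaleDl.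

Fact proj_is_linear : linear proj.
Proof. by move=> a x y; rewrite projD proj_scale. Qed.
HB.instance Definition _ := GRing.isLinear.Build K V quotient *:%R proj
  proj_is_linear.

Lemma proj_eq0 x : proj x = 0 <-> x \in S.
Proof. by rewrite -[0](raddf0 proj) proj_eq subr0. Qed.

(* The map induced on the quotient; meaningful when [f] kills [S]. *)
Definition quotient_lift (W : Type) (f : V -> W) (q : quotient) : W :=
  f (repr q).

Lemma quotient_liftE (W : lmodType K) (f : V -> W) x :
  linear f -> (forall x, x \in S -> f x = 0) ->
  quotient_lift f (proj x) = f x.
Proof.
move=> lin_f fS; rewrite /quotient_lift -[in RHS](subrK (repr (proj x)) x).
have h : f (x - repr (proj x)) = 0 by apply/fS/proj_eq; rewrite projK.
by have := lin_f 1 (x - repr (proj x)) (repr (proj x)); rewrite !scale1r h add0r.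
Qed.

Lemma quotient_lift_linear (W : lmodType K) (f : V -> W) :
  linear f -> (forall x, x \in S -> f x = 0) -> linear (quotient_lift f).
Proof.
move=> lin_f fS a q r; rewrite -[q]projK -[r]projK -linearP.
by rewrite !quotient_liftE //; exact: lin_f.
Qed.

End Quotients.

(* The space [A / (A :&: B)]; it is only used for [B] contained in [A]. *)
Section Subquotients.
Variables (K : fieldType) (V : lmodType K) (A B : submodClosed V).

Definition subquotient : lmodType K :=
  quotient (preim_submod (\val : {linear subspace A -> V}) B).

Definition subproj (x : subspace A) : subquotient := proj _ x.
Fact subproj_is_linear : linear subproj.
Proof. exact: proj_is_linear. Qed.
HB.instance Definition _ := GRing.isLinear.Build K (subspace A) subquotient
  *:%R subproj subproj_is_linear.

End Subquotients.

Section Tensor.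
Variables (K : fieldType) (A B : lmodType K).

Definition free_pair (a : A) (b : B) : {freeg (A * B)%type / K} := << (a, b) >>.

Inductive tensor_rel : set {freeg (A * B)%type / K} :=
| tensor_rel_l c a a' b : tensor_rel
    (free_pair (c *: a + a') b - (c *: free_pair a b + free_pair a' b))
| tensor_rel_r c a b b' : tensor_rel
    (free_pair a (c *: b + b') - (c *: free_pair a b + free_pair a b')).

Definition tensor : lmodType K := quotient (span tensor_rel).

Definition tens (a : A) (b : B) : tensor := proj _ (free_pair a b).

Lemma tens_l c a a' b : tens (c *: a + a') b = c *: tens a b + tens a' b.
Proof.
rewrite /tens -linearP; apply/proj_eq; apply: mem_span; exact: tensor_rel_l.
Qed.

Lemma tens_r c a b b' : tens a (c *: b + b') = c *: tens a b + tens a b'.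
Proof.
rewrite /tens -linearP; apply/proj_eq; apply: mem_span; exact: tensor_rel_r.
Qed.

(* The map induced by [f]; meaningful when [f] is bilinear. *)
Definition tensor_lift (C : lmodType K) (f : A -> B -> C) : tensor -> C :=
  quotient_lift (fglift (fun p => f p.1 p.2)).

Section Lift.
Variables (C : lmodType K) (f : A -> B -> C).
Hypothesis f_l : forall c a a' b, f (c *: a + a') b = c *: f a b + f a' b.
Hypothesis f_r : forall c a b b', f a (c *: b + b') = c *: f a b + f a b'.

Let free_lift (x : {freeg (A * B)%type / K}) : C :=
  fglift (fun p => f p.1 p.2) x.

Let free_lift_is_linear : linear free_lift.
Proof.
have flB x y : free_lift (x - y) = free_lift x - free_lift y.
  exact: lift_is_additive.
have fl0 : free_lift 0 = 0 by rewrite -(subrr 0) flB subrr.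
have flD x y : free_lift (x + y) = free_lift x + free_lift y.
  by rewrite -{1}[y]opprK flB -[- y]sub0r flB fl0 sub0r opprK.
move=> c x y; rewrite flD; congr (_ + _).
elim/freeg_ind_dom0: x => [|k z D _ _ IH]; first by rewrite !(scaler0, fl0).
rewrite scalerDr !flD IH scalerDr; congr (_ + _).
have -> : c *: << k *g z >> = << c * k *g z >> :> {freeg (A * B)%type / K}.
  by apply/eqP/freeg_eqP => p; rewrite coeffZ !coeffU mulrA.
by rewrite /free_lift !liftU scalerA.
Qed.

Let free_lift_pair a b : free_lift (free_pair a b) = f a b.
Proof. by rewrite /free_lift liftU scale1r. Qed.

Let free_lift_rel x : x \in span tensor_rel -> free_lift x = 0.
Proof.
apply: linear_span0 => // _ [c a a' b|c a b b'];
  by rewrite -[X in _ - X]scale1r -scaleNr addrC free_lift_is_linear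
             free_lift_is_linear !free_lift_pair ?f_l ?f_r scaleN1r addNr.
Qed.

Lemma tensor_liftE a b : tensor_lift f (tens a b) = f a b.
Proof. by rewrite /tensor_lift quotient_liftE // free_lift_pair. Qed.

Lemma tensor_lift_linear : linear (tensor_lift f).
Proof. exact: quotient_lift_linear. Qed.

End Lift.

Lemma tensor_ind (S : submodClosed tensor) :
  (forall a b, tens a b \in S) -> forall x, x \in S.
Proof.
move=> h x; rewrite -[x]projK.
elim/freeg_ind_dom0: (repr x) => [|k [a b] D _ _ IH].
  by rewrite linear0 rpred0.
rewrite linearD rpredD //.
have -> : << k *g (a, b) >> = k *: free_pair a b.
  by apply/eqP/freeg_eqP => p; rewrite coeffZ !coeffU mul1r.
by rewrite linearZ rpredZ //; exact: h.
Qed.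

End Tensor.

Section TensorMap.
Variables (K : fieldType) (A A' B B' : lmodType K).
Variables (f : {linear A -> A'}) (g : {linear B -> B'}).

Definition tensor_map : tensor A B -> tensor A' B' :=
  tensor_lift (fun a b => tens (f a) (g b)).

Let map_l c a a' b :
  tens (f (c *: a + a')) (g b) = c *: tens (f a) (g b) + tens (f a') (g b).
Proof. by rewrite linearP tens_l. Qed.

Let map_r c a b b' :
  tens (f a) (g (c *: b + b')) = c *: tens (f a) (g b) + tens (f a) (g b').
Proof. by rewrite linearP tens_r. Qed.

Lemma tensor_mapE a b : tensor_map (tens a b) = tens (f a) (g b).
Proof. exact: (tensor_liftE map_l map_r). Qed.

HB.instance Definition _ := GRing.isLinear.Build K (tensor A B)
  (tensor A' B') *:%R tensor_map (tensor_lift_linear map_l map_r).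

End TensorMap.

Section ExteriorSquare.
Variables (K : fieldType) (V : lmodType K).

Definition ext2 : lmodType K :=
  quotient (span [set tens v v | v in [set: V]]).

Definition wedge (v w : V) : ext2 := proj _ (tens v w).

Lemma wedge_vv v : wedge v v = 0.
Proof. by apply/proj_eq0/mem_span; exists v. Qed.

Lemma wedge_l c v v' w : wedge (c *: v + v') w = c *: wedge v w + wedge v' w.
Proof. by rewrite /wedge tens_l linearP. Qed.

Lemma wedge_r c v w w' : wedge v (c *: w + w') = c *: wedge v w + wedge v w'.
Proof. by rewrite /wedge tens_r linearP. Qed.

(* The map induced by [f]; meaningful when [f] is bilinear alternating. *)
Definition ext2_lift (C : lmodType K) (f : V -> V -> C) : ext2 -> C :=
  quotient_lift (tensor_lift f).

Section Lift.
Variables (C : lmodType K) (f : V -> V -> C).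
Hypothesis f_l : forall c a a' b, f (c *: a + a') b = c *: f a b + f a' b.
Hypothesis f_r : forall c a b b', f a (c *: b + b') = c *: f a b + f a b'.
Hypothesis f_alt : forall a, f a a = 0.

Let lin := tensor_lift_linear f_l f_r.

Let lift0 x :
  x \in span [set tens v v | v in [set: V]] -> tensor_lift f x = 0.
Proof. by apply: linear_span0 => // _ [v _ <-]; rewrite tensor_liftE. Qed.

Lemma ext2_liftE v w : ext2_lift f (wedge v w) = f v w.
Proof. by rewrite /ext2_lift quotient_liftE // tensor_liftE. Qed.

Lemma ext2_lift_linear : linear (ext2_lift f).
Proof. exact: quotient_lift_linear. Qed.

End Lift.

End ExteriorSquare.

Section ExteriorSquareMap.
Variables (K : fieldType) (V W : lmodType K) (f : {linear V -> W}).

Definition ext2_map : ext2 V -> ext2 W :=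
  ext2_lift (fun v w => wedge (f v) (f w)).

Let map_l c a a' b : wedge (f (c *: a + a')) (f b) =
  c *: wedge (f a) (f b) + wedge (f a') (f b).
Proof. by rewrite linearP wedge_l. Qed.
Let map_r c a b b' : wedge (f a) (f (c *: b + b')) =
  c *: wedge (f a) (f b) + wedge (f a) (f b').
Proof. by rewrite linearP wedge_r. Qed.
Let map_alt a : wedge (f a) (f a) = 0.
Proof. exact: wedge_vv. Qed.

Lemma ext2_mapE v w : ext2_map (wedge v w) = wedge (f v) (f w).
Proof. exact: (ext2_liftE map_l map_r map_alt). Qed.

HB.instance Definition _ := GRing.isLinear.Build K (ext2 V) (ext2 W) *:%R
  ext2_map (ext2_lift_linear map_l map_r map_alt).

End ExteriorSquareMap.

(* [Sym U] is the commutative [K]-algebra generated by the symbols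
    [SGen u], linear in [u]: formal expressions modulo the congruence
    generated by the axioms. *)

Section SymmetricAlgebra.
Variables (K : fieldType) (U : lmodType K).

Inductive sym_term :=
| SGen of U
| SConst of K
| SAdd of sym_term & sym_term
| SMul of sym_term & sym_term.

HB.instance Definition _ := gen_eqMixin sym_term.
HB.instance Definition _ := gen_choiceMixin sym_term.

Inductive sym_rel : sym_term -> sym_term -> Prop :=
| sym_refl t : sym_rel t t
| sym_sym s t : sym_rel s t -> sym_rel t s
| sym_trans s t u : sym_rel s t -> sym_rel t u -> sym_rel s u
| sym_add s s' t t' :
    sym_rel s s' -> sym_rel t t' -> sym_rel (SAdd s t) (SAdd s' t')
| sym_mul s s' t t' :
    sym_rel s s' -> sym_rel t t' -> sym_rel (SMul s t) (SMul s' t')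
| sym_addA s t u : sym_rel (SAdd s (SAdd t u)) (SAdd (SAdd s t) u)
| sym_addC s t : sym_rel (SAdd s t) (SAdd t s)
| sym_add0 t : sym_rel (SAdd (SConst 0) t) t
| sym_addN t : sym_rel (SAdd (SMul (SConst (- 1)) t) t) (SConst 0)
| sym_mulA s t u : sym_rel (SMul s (SMul t u)) (SMul (SMul s t) u)
| sym_mulC s t : sym_rel (SMul s t) (SMul t s)
| sym_mul1 t : sym_rel (SMul (SConst 1) t) t
| sym_mulDl s t u :
    sym_rel (SMul (SAdd s t) u) (SAdd (SMul s u) (SMul t u))
| sym_constD a b : sym_rel (SConst (a + b)) (SAdd (SConst a) (SConst b))
| sym_constM a b : sym_rel (SConst (a * b)) (SMul (SConst a) (SConst b))
| sym_gen a u v : sym_rel (SGen (a *: u + v))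
    (SAdd (SMul (SConst a) (SGen u)) (SGen v)).

Definition sym_relb (s t : sym_term) : bool := `[< sym_rel s t >].

Fact sym_relb_equiv : equiv_class_of sym_relb.
Proof.
split=> [t|s t|t s u].
- exact/asboolP/sym_refl.
- by apply/asboolP/asboolP; exact: sym_sym.
- by move=> /asboolP st /asboolP tu; apply/asboolP/(sym_trans st).
Qed.
Canonical sym_relb_equiv_rel := EquivRelPack sym_relb_equiv.
Canonical sym_relb_encModRel := defaultEncModRel sym_relb.

Definition Sym := {eq_quot sym_relb}.
HB.instance Definition _ := EqQuotient.on Sym.
HB.instance Definition _ := Choice.on Sym.

Definition sclass (t : sym_term) : Sym := \pi t.

Lemma sclassK (p : Sym) : sclass (repr p) = p.
Proof. exact: reprK. Qed.

Lemma sclassP s t : sclass s = sclass t <-> sym_rel s t.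
Proof.
split=> [/eqmodP /asboolP //|st].
by apply/eqmodP/asboolP.
Qed.

Definition sym_plus (p q : Sym) : Sym := sclass (SAdd (repr p) (repr q)).
Definition sym_times (p q : Sym) : Sym := sclass (SMul (repr p) (repr q)).
Definition sym_opp (p : Sym) : Sym := sym_times (sclass (SConst (- 1))) p.
Definition sym_scale (a : K) (p : Sym) : Sym := sym_times (sclass (SConst a)) p.

Let reprP t : sym_rel (repr (sclass t)) t.
Proof. by apply/sclassP; rewrite sclassK. Qed.

Lemma sclass_add s t : sclass (SAdd s t) = sym_plus (sclass s) (sclass t).
Proof. by apply/sclassP/sym_sym/sym_add; exact: reprP. Qed.

Lemma sclass_mul s t : sclass (SMul s t) = sym_times (sclass s) (sclass t).
Proof. by apply/sclassP/sym_sym/sym_mul; exact: reprP. Qed.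

Let sE := (sclass_add, sclass_mul).

Fact sym_plusA : associative sym_plus.
Proof.
move=> p q r; rewrite -[p]sclassK -[q]sclassK -[r]sclassK -!sE.
exact/sclassP/sym_addA.
Qed.
Fact sym_plusC : commutative sym_plus.
Proof.
by move=> p q; rewrite -[p]sclassK -[q]sclassK -!sE; apply/sclassP/sym_addC.
Qed.
Fact sym_plus0 : left_id (sclass (SConst 0)) sym_plus.
Proof. by move=> p; rewrite -[p]sclassK -!sE; apply/sclassP/sym_add0. Qed.
Fact sym_plusN : left_inverse (sclass (SConst 0)) sym_opp sym_plus.
Proof.
by move=> p; rewrite -[p]sclassK /sym_opp -!sE; apply/sclassP/sym_addN.
Qed.
HB.instance Definition _ :=
  GRing.isZmodule.Build Sym sym_plusA sym_plusC sym_plus0 sym_plusN.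

Fact sym_timesA : associative sym_times.
Proof.
move=> p q r; rewrite -[p]sclassK -[q]sclassK -[r]sclassK -!sE.
exact/sclassP/sym_mulA.
Qed.
Fact sym_timesC : commutative sym_times.
Proof.
by move=> p q; rewrite -[p]sclassK -[q]sclassK -!sE; apply/sclassP/sym_mulC.
Qed.
Fact sym_times1 : left_id (sclass (SConst 1)) sym_times.
Proof. by move=> p; rewrite -[p]sclassK -!sE; apply/sclassP/sym_mul1. Qed.
Fact sym_timesDl : left_distributive sym_times sym_plus.
Proof.
move=> p q r; rewrite -[p]sclassK -[q]sclassK -[r]sclassK -!sE.
exact/sclassP/sym_mulDl.
Qed.

Fixpoint sym_eval0 (t : sym_term) : K :=
  match t with
  | SGen _ => 0
  | SConst a => a
  | SAdd s t => sym_eval0 s + sym_eval0 t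
  | SMul s t => sym_eval0 s * sym_eval0 t
  end.

Lemma sym_eval0P s t : sym_rel s t -> sym_eval0 s = sym_eval0 t.
Proof.
elim=> //= *; rewrite ?(addr0, add0r, mul1r, mulr0, mulrDl, mulN1r, addNr) //;
  by [congruence | rewrite ?(addrA, mulrA) | rewrite addrC | rewrite mulrC].
Qed.

Fact sym_one_neq0 : sclass (SConst 1) != sclass (SConst 0).
Proof.
by apply/eqP => /sclassP /sym_eval0P /= /eqP; rewrite oner_eq0.
Qed.

HB.instance Definition _ := GRing.Zmodule_isComNzRing.Build Sym
  sym_timesA sym_timesC sym_times1 sym_timesDl sym_one_neq0.

Fact sym_scaleA a b p : sym_scale a (sym_scale b p) = sym_scale (a * b) p.
Proof.
rewrite /sym_scale sym_timesA -sclass_mul; congr sym_times.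
exact/sclassP/sym_sym/sym_constM.
Qed.
Fact sym_scale1 : left_id 1 sym_scale.
Proof. exact: sym_times1. Qed.
Fact sym_scaleDr : right_distributive sym_scale +%R.
Proof. by move=> a p q; exact: mulrDr. Qed.
Fact sym_scaleDl p : {morph sym_scale^~ p : a b / a + b}.
Proof.
move=> a b; rewrite -[RHS]sym_timesDl -sclass_add; congr sym_times.
exact/sclassP/sym_constD.
Qed.
HB.instance Definition _ := GRing.Zmodule_isLmodule.Build K Sym
  sym_scaleA sym_scale1 sym_scaleDr sym_scaleDl.

Fact sym_scaleAl (a : K) (p q : Sym) : a *: (p * q) = a *: p * q.
Proof. exact: mulrA. Qed.
HB.instance Definition _ := GRing.Lmodule_isLalgebra.Build K Sym sym_scaleAl.
HB.instance Definition _ := GRing.Lalgebra_isComAlgebra.Build K Sym.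

Definition sgen (u : U) : Sym := sclass (SGen u).

Fact sgen_is_linear : linear sgen.
Proof.
move=> a u v; transitivity (sclass (SAdd (SMul (SConst a) (SGen u)) (SGen v))).
  exact/sclassP/sym_gen.
by rewrite sclass_add sclass_mul.
Qed.
HB.instance Definition _ := GRing.isLinear.Build K U Sym *:%R sgen
  sgen_is_linear.

Definition sym_deg (r : nat) : submodClosed Sym :=
  span [set p | exists2 us : r.-tuple U, true & p = \prod_(u <- us) sgen u].

Definition Symr (r : nat) : lmodType K := subspace (sym_deg r).

Fact sym_prod_deg r (us : r.-tuple U) : \prod_(u <- us) sgen u \in sym_deg r.
Proof. by apply: mem_span; exists us. Qed.

Definition sym_prod r (us : r.-tuple U) : Symr r :=
  insubspace (sym_prod_deg us).

End SymmetricAlgebra.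

Section SymMap.
Variables (K : fieldType) (U V : lmodType K) (f : {linear U -> V}).

Fixpoint sym_term_map (t : sym_term U) : sym_term V :=
  match t with
  | SGen u => SGen (f u)
  | SConst a => SConst V a
  | SAdd s t => SAdd (sym_term_map s) (sym_term_map t)
  | SMul s t => SMul (sym_term_map s) (sym_term_map t)
  end.

Definition sym_map (p : Sym U) : Sym V := sclass (sym_term_map (repr p)).

Lemma sym_term_mapP s t :
  sym_rel s t -> sym_rel (sym_term_map s) (sym_term_map t).
Proof.
elim=> //=; try by constructor.
- by move=> s' t' u' _ h _; exact: sym_trans.
- by move=> a u v; rewrite linearP; exact: sym_gen.
Qed.

Lemma sym_map_class t : sym_map (sclass t) = sclass (sym_term_map t).
Proof. by apply/sclassP/sym_term_mapP/sclassP; rewrite sclassK. Qed.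

Lemma sym_map_gen u : sym_map (sgen u) = sgen (f u).
Proof. exact: sym_map_class. Qed.

Lemma sym_mapM p q : sym_map (p * q) = sym_map p * sym_map q.
Proof.
by rewrite -[p]sclassK -[q]sclassK -[_ * _]sclass_mul !sym_map_class /=
           sclass_mul.
Qed.

Lemma sym_map1 : sym_map 1 = 1.
Proof. exact: sym_map_class. Qed.

Fact sym_map_is_linear : linear sym_map.
Proof.
move=> a p q; rewrite -[p]sclassK -[q]sclassK.
have -> : a *: sclass (repr p) + sclass (repr q) =
    sclass (SAdd (SMul (SConst U a) (repr p)) (repr q)).
  by rewrite sclass_add sclass_mul.
by rewrite !sym_map_class /= sclass_add sclass_mul.
Qed.
HB.instance Definition _ := GRing.isLinear.Build K (Sym U) (Sym V) *:%R sym_map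
  sym_map_is_linear.

Fact sym_map_deg r p : p \in sym_deg U r -> sym_map p \in sym_deg V r.
Proof.
move=> hp; apply/(submod_ofP (preim_is_submod sym_map (sym_deg V r))).
move: p hp; apply: span_min => _ [us _ ->]; apply/submod_ofP => /=.
have -> : sym_map (\prod_(u <- us) sgen u) = \prod_(v <- map_tuple f us) sgen v.
  rewrite big_map; elim: (us : seq U) => [|u s IH].
    by rewrite !big_nil sym_map1.
  by rewrite !big_cons sym_mapM sym_map_gen IH.
exact: sym_prod_deg.
Qed.

Definition symr_map r (p : Symr U r) : Symr V r :=
  insubspace (sym_map_deg (valP p)).

Fact symr_map_is_linear r : linear (@symr_map r).
Proof. by move=> a p q; apply: val_inj; rewrite /= !linearP. Qed.
HB.instance Definition _ r := GRing.isLinear.Build K (Symr U r) (Symr V r)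
  *:%R (@symr_map r) (@symr_map_is_linear r).

End SymMap.

HB.mixin Record isLieAlgebra (K : fieldType) L of GRing.Lmodule K L := {
  lie : L -> L -> L;
  lie_l : forall c x y z, lie (c *: x + y) z = c *: lie x z + lie y z;
  lie_r : forall c x y z, lie x (c *: y + z) = c *: lie x y + lie x z;
  lie_xx : forall x, lie x x = 0;
  lie_jacobi : forall x y z,
    lie x (lie y z) + lie y (lie z x) + lie z (lie x y) = 0
}.

#[short(type="lieAlgType")]
HB.structure Definition LieAlgebra (K : fieldType) :=
  {L of GRing.Lmodule K L & isLieAlgebra K L}.

Section LieTheory.
Variables (K : fieldType) (L : lieAlgType K).
Implicit Types x y z : L.

Lemma lieDl x y z : lie (x + y) z = lie x z + lie y z.
Proof. by rewrite -[x]scale1r lie_l !scale1r. Qed.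
Lemma lieDr x y z : lie x (y + z) = lie x y + lie x z.
Proof. by rewrite -[y]scale1r lie_r !scale1r. Qed.
Lemma lie0l z : lie 0 z = 0.
Proof. by apply: (@addrI _ (lie 0 z)); rewrite -lieDl !addr0. Qed.
Lemma lie0r z : lie z 0 = 0.
Proof. by apply: (@addrI _ (lie z 0)); rewrite -lieDr !addr0. Qed.
Lemma lieZl a x z : lie (a *: x) z = a *: lie x z.
Proof. by rewrite -[a *: x]addr0 lie_l lie0l addr0. Qed.
Lemma lieZr a x z : lie z (a *: x) = a *: lie z x.
Proof. by rewrite -[a *: x]addr0 lie_r lie0r addr0. Qed.
Lemma lieC x y : lie x y = - lie y x.
Proof.
have := lie_xx (x + y); rewrite lieDl !lieDr !lie_xx add0r addr0.
by move/eqP; rewrite addr_eq0 => /eqP.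
Qed.
Lemma lieNl x y : lie (- x) y = - lie x y.
Proof. by rewrite -!scaleN1r lieZl. Qed.
Lemma lieNr x y : lie x (- y) = - lie x y.
Proof. by rewrite -!scaleN1r lieZr. Qed.
Lemma lie_leibniz x y z : lie x (lie y z) = lie (lie x y) z + lie y (lie x z).
Proof.
have /eqP := lie_jacobi x y z; rewrite -addrA addr_eq0 => /eqP ->.
by rewrite (lieC z (lie x y)) (lieC z x) lieNr opprD !opprK addrC.
Qed.

Record lieIdeal := LieIdeal {
  ideal_space :> submodClosed L;
  ideal_lie : forall x y, y \in ideal_space -> lie x y \in ideal_space }.

Definition full_ideal : lieIdeal :=
  @LieIdeal (submod_of (full_is_submod L))
    (fun x y _ => (submod_ofP (full_is_submod L) (lie x y)).2 I).

Fact lie_is_linear x : linear (lie x).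
Proof. by move=> a y z; exact: lie_r. Qed.
HB.instance Definition _ x := GRing.isLinear.Build K L L *:%R (lie x)
  (lie_is_linear x).

Definition commutator_space (I J : lieIdeal) : submodClosed L :=
  span [set z | exists x y, [/\ x \in ideal_space I, y \in ideal_space J
                                & z = lie x y]].

Fact commutator_lie I J z x :
  x \in commutator_space I J -> lie z x \in commutator_space I J.
Proof.
move=> hx; apply/(submod_ofP (preim_is_submod (lie z) (commutator_space I J))).
move: x hx; apply: span_min => _ [x [y [Ix Jy ->]]]; apply/submod_ofP => /=.
rewrite lie_leibniz rpredD //; apply: mem_span.
  by exists (lie z x), y; split=> //; exact: ideal_lie.
by exists x, (lie z y); split=> //; exact: ideal_lie.
Qed.

Definition commutator (I J : lieIdeal) : lieIdeal :=
  LieIdeal (@commutator_lie I J).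

Lemma lie_in_commutator (I J : lieIdeal) x y :
  x \in ideal_space I -> y \in ideal_space J ->
  lie x y \in ideal_space (commutator I J).
Proof. by move=> Ix Jy; apply: mem_span; exists x, y. Qed.

Lemma mem_full x : x \in ideal_space full_ideal.
Proof. exact: (submod_ofP (full_is_submod L) x).2. Qed.

Definition derived : lieIdeal := commutator full_ideal full_ideal.

(* The lower central series, numbered from [lcs 1 = L]. *)
Definition lcs (j : nat) : lieIdeal :=
  iter j.-1 (commutator full_ideal) full_ideal.

(* [ad_iter [:: u_1; ...; u_r] x] is [ad_{u_r} ... ad_{u_1} x]. *)
Definition ad_iter (us : seq L) (x : L) : L := foldl (fun y u => lie u y) x us.

Fact ad_iter_lcs r (us : r.-tuple L) v w :
  ad_iter us (lie v w) \in ideal_space (lcs r.+2).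
Proof.
have h s j x : x \in ideal_space (lcs j.+1) ->
    ad_iter s x \in ideal_space (lcs (size s + j).+1).
  elim: s j x => [//|u s IH] j x Lx; rewrite [size _]/= addSnnS; apply: IH.
  by apply: lie_in_commutator => //; exact: mem_full.
have := h us 1%N (lie v w); rewrite size_tuple addn1; apply.
by apply: lie_in_commutator; exact: mem_full.
Qed.

End LieTheory.

Section LieQuotient.
Variables (K : fieldType) (L : lieAlgType K) (I : lieIdeal L).

Definition lie_quotient := quotient I.
HB.instance Definition _ := GRing.Lmodule.on lie_quotient.

Definition lproj (x : L) : lie_quotient := proj I x.
HB.instance Definition _ := GRing.isLinear.Build K L lie_quotient *:%R lproj
  (@proj_is_linear K L I).

Definition quotient_bracket (q r : lie_quotient) : lie_quotient :=
  lproj (lie (repr q) (repr r)).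

Lemma lproj_bracket x y :
  lproj (lie x y) = quotient_bracket (lproj x) (lproj y).
Proof.
apply/proj_eq.
have hI (z : L) : z - repr (lproj z) \in ideal_space I.
  by apply/proj_eq; rewrite projK.
set x' := repr (lproj x); set y' := repr (lproj y).
have -> : lie x y - lie x' y' = lie x (y - y') - lie y' (x - x').
  by rewrite (lieC y') opprK lieDr lieNr lieDl lieNl addrA subrK.
by rewrite submodB //; apply: ideal_lie; exact: hI.
Qed.

Let lprojK (q : lie_quotient) : lproj (repr q) = q.
Proof. exact: projK. Qed.

Fact quotient_bracket_l c (x y z : lie_quotient) :
  quotient_bracket (c *: x + y) z =
  c *: quotient_bracket x z + quotient_bracket y z.
Proof.
rewrite -[x]lprojK -[y]lprojK -[z]lprojK -linearP -!lproj_bracket lie_l.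
exact: linearP.
Qed.
Fact quotient_bracket_r c (x y z : lie_quotient) :
  quotient_bracket x (c *: y + z) =
  c *: quotient_bracket x y + quotient_bracket x z.
Proof.
rewrite -[x]lprojK -[y]lprojK -[z]lprojK -linearP -!lproj_bracket lie_r.
exact: linearP.
Qed.
Fact quotient_bracket_xx x : quotient_bracket x x = 0.
Proof. by rewrite -[x]lprojK -lproj_bracket lie_xx linear0. Qed.
Fact quotient_bracket_jacobi x y z :
  quotient_bracket x (quotient_bracket y z) +
  quotient_bracket y (quotient_bracket z x) +
  quotient_bracket z (quotient_bracket x y) = 0.
Proof.
rewrite -[x]lprojK -[y]lprojK -[z]lprojK -!lproj_bracket -!linearD.
by rewrite lie_jacobi linear0.
Qed.
HB.instance Definition _ := isLieAlgebra.Build K lie_quotient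
  quotient_bracket_l quotient_bracket_r quotient_bracket_xx
  quotient_bracket_jacobi.

Lemma lproj_lie x y : lproj (lie x y) = lie (lproj x) (lproj y).
Proof. exact: lproj_bracket. Qed.

End LieQuotient.

(* [FreeLie U] is the Lie algebra generated by the symbols [LGen u], linear
    in [u]: formal expressions modulo the congruence generated by the
    axioms. *)

Section FreeLie.
Variables (K : fieldType) (U : lmodType K).

Inductive lie_term :=
| LGen of U
| LZero
| LAdd of lie_term & lie_term
| LScale of K & lie_term
| LBracket of lie_term & lie_term.

HB.instance Definition _ := gen_eqMixin lie_term.
HB.instance Definition _ := gen_choiceMixin lie_term.

Inductive lie_rel : lie_term -> lie_term -> Prop :=
| lrel_refl t : lie_rel t t
| lrel_sym s t : lie_rel s t -> lie_rel t s
| lrel_trans s t u : lie_rel s t -> lie_rel t u -> lie_rel s u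
| lrel_add s s' t t' :
    lie_rel s s' -> lie_rel t t' -> lie_rel (LAdd s t) (LAdd s' t')
| lrel_scale a t t' : lie_rel t t' -> lie_rel (LScale a t) (LScale a t')
| lrel_bracket s s' t t' :
    lie_rel s s' -> lie_rel t t' -> lie_rel (LBracket s t) (LBracket s' t')
| lrel_addA s t u : lie_rel (LAdd s (LAdd t u)) (LAdd (LAdd s t) u)
| lrel_addC s t : lie_rel (LAdd s t) (LAdd t s)
| lrel_add0 t : lie_rel (LAdd LZero t) t
| lrel_addN t : lie_rel (LAdd (LScale (- 1) t) t) LZero
| lrel_scaleA a b t : lie_rel (LScale a (LScale b t)) (LScale (a * b) t)
| lrel_scale1 t : lie_rel (LScale 1 t) t
| lrel_scaleDr a s t :
    lie_rel (LScale a (LAdd s t)) (LAdd (LScale a s) (LScale a t))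
| lrel_scaleDl a b t :
    lie_rel (LScale (a + b) t) (LAdd (LScale a t) (LScale b t))
| lrel_bracket_l a s t u : lie_rel (LBracket (LAdd (LScale a s) t) u)
    (LAdd (LScale a (LBracket s u)) (LBracket t u))
| lrel_bracket_r a s t u : lie_rel (LBracket s (LAdd (LScale a t) u))
    (LAdd (LScale a (LBracket s t)) (LBracket s u))
| lrel_bracket_xx t : lie_rel (LBracket t t) LZero
| lrel_jacobi s t u : lie_rel
    (LAdd (LAdd (LBracket s (LBracket t u)) (LBracket t (LBracket u s)))
          (LBracket u (LBracket s t))) LZero
| lrel_gen a u v : lie_rel (LGen (a *: u + v)) (LAdd (LScale a (LGen u)) (LGen v)).

Definition lie_relb (s t : lie_term) : bool := `[< lie_rel s t >].

Fact lie_relb_equiv : equiv_class_of lie_relb.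
Proof.
split=> [t|s t|t s u].
- exact/asboolP/lrel_refl.
- by apply/asboolP/asboolP; exact: lrel_sym.
- by move=> /asboolP st /asboolP tu; apply/asboolP/(lrel_trans st).
Qed.
Canonical lie_relb_equiv_rel := EquivRelPack lie_relb_equiv.
Canonical lie_relb_encModRel := defaultEncModRel lie_relb.

Definition FreeLie := {eq_quot lie_relb}.
HB.instance Definition _ := EqQuotient.on FreeLie.
HB.instance Definition _ := Choice.on FreeLie.

Definition lclass (t : lie_term) : FreeLie := \pi t.

Lemma lclassK (p : FreeLie) : lclass (repr p) = p.
Proof. exact: reprK. Qed.

Lemma lclassP s t : lclass s = lclass t <-> lie_rel s t.
Proof.
split=> [/eqmodP /asboolP //|st].
by apply/eqmodP/asboolP.
Qed.

Let reprP t : lie_rel (repr (lclass t)) t.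
Proof. by apply/lclassP; rewrite lclassK. Qed.

Definition free_add (p q : FreeLie) := lclass (LAdd (repr p) (repr q)).
Definition free_scale (a : K) (p : FreeLie) := lclass (LScale a (repr p)).
Definition free_bracket (p q : FreeLie) := lclass (LBracket (repr p) (repr q)).
Definition free_opp (p : FreeLie) := free_scale (- 1) p.

Lemma lclass_add s t : lclass (LAdd s t) = free_add (lclass s) (lclass t).
Proof. by apply/lclassP/lrel_sym/lrel_add; exact: reprP. Qed.
Lemma lclass_scale a t : lclass (LScale a t) = free_scale a (lclass t).
Proof. by apply/lclassP/lrel_sym/lrel_scale; exact: reprP. Qed.
Lemma lclass_bracket s t :
  lclass (LBracket s t) = free_bracket (lclass s) (lclass t).
Proof. by apply/lclassP/lrel_sym/lrel_bracket; exact: reprP. Qed.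

Let lE := (lclass_add, lclass_scale, lclass_bracket).

Fact free_addA : associative free_add.
Proof.
move=> p q r; rewrite -[p]lclassK -[q]lclassK -[r]lclassK -!lE.
exact/lclassP/lrel_addA.
Qed.
Fact free_addC : commutative free_add.
Proof.
by move=> p q; rewrite -[p]lclassK -[q]lclassK -!lE; apply/lclassP/lrel_addC.
Qed.
Fact free_add0 : left_id (lclass LZero) free_add.
Proof. by move=> p; rewrite -[p]lclassK -!lE; apply/lclassP/lrel_add0. Qed.
Fact free_addN : left_inverse (lclass LZero) free_opp free_add.
Proof.
by move=> p; rewrite -[p]lclassK /free_opp -!lE; apply/lclassP/lrel_addN.
Qed.
HB.instance Definition _ :=
  GRing.isZmodule.Build FreeLie free_addA free_addC free_add0 free_addN.

Fact free_scaleA a b p : free_scale a (free_scale b p) = free_scale (a * b) p.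
Proof. by rewrite -[p]lclassK -!lE; apply/lclassP/lrel_scaleA. Qed.
Fact free_scale1 : left_id 1 free_scale.
Proof. by move=> p; rewrite -[p]lclassK -!lE; apply/lclassP/lrel_scale1. Qed.
Fact free_scaleDr : right_distributive free_scale free_add.
Proof.
move=> a p q; rewrite -[p]lclassK -[q]lclassK -!lE.
exact/lclassP/lrel_scaleDr.
Qed.
Fact free_scaleDl p a b :
  free_scale (a + b) p = free_add (free_scale a p) (free_scale b p).
Proof. by rewrite -[p]lclassK -!lE; apply/lclassP/lrel_scaleDl. Qed.
HB.instance Definition _ := GRing.Zmodule_isLmodule.Build K FreeLie
  free_scaleA free_scale1 free_scaleDr free_scaleDl.

Fact free_bracket_l c (p q r : FreeLie) :
  free_bracket (c *: p + q) r = c *: free_bracket p r + free_bracket q r.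
Proof.
rewrite -[p]lclassK -[q]lclassK -[r]lclassK.
rewrite -[_ *: lclass _]lclass_scale -[_ + lclass _]lclass_add -!lclass_bracket.
rewrite -[_ *: lclass _]lclass_scale -[RHS]lclass_add.
exact/lclassP/lrel_bracket_l.
Qed.
Fact free_bracket_r c (p q r : FreeLie) :
  free_bracket p (c *: q + r) = c *: free_bracket p q + free_bracket p r.
Proof.
rewrite -[p]lclassK -[q]lclassK -[r]lclassK.
rewrite -[_ *: lclass _]lclass_scale -[_ + lclass _]lclass_add -!lclass_bracket.
rewrite -[_ *: lclass _]lclass_scale -[RHS]lclass_add.
exact/lclassP/lrel_bracket_r.
Qed.
Fact free_bracket_xx p : free_bracket p p = 0.
Proof. by rewrite -[p]lclassK -!lE; apply/lclassP/lrel_bracket_xx. Qed.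
Fact free_bracket_jacobi p q r :
  free_bracket p (free_bracket q r) + free_bracket q (free_bracket r p)
  + free_bracket r (free_bracket p q) = 0.
Proof.
rewrite -[p]lclassK -[q]lclassK -[r]lclassK -!lclass_bracket.
rewrite -[lclass _ + lclass _]lclass_add -[_ + lclass _]lclass_add.
exact/lclassP/lrel_jacobi.
Qed.
HB.instance Definition _ := isLieAlgebra.Build K FreeLie
  free_bracket_l free_bracket_r free_bracket_xx free_bracket_jacobi.

Definition free_gen (u : U) : FreeLie := lclass (LGen u).

Fact free_gen_is_linear : linear free_gen.
Proof.
move=> a u v; transitivity (lclass (LAdd (LScale a (LGen u)) (LGen v))).
  exact/lclassP/lrel_gen.
by rewrite lclass_add lclass_scale.
Qed.
HB.instance Definition _ := GRing.isLinear.Build K U FreeLie *:%R free_gen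
  free_gen_is_linear.

Lemma free_lie_ind (P : FreeLie -> Prop) :
  (forall u, P (free_gen u)) -> P 0 -> (forall p q, P p -> P q -> P (p + q)) ->
  (forall a p, P p -> P (a *: p)) ->
  (forall p q, P p -> P q -> P (lie p q)) -> forall p, P p.
Proof.
move=> Pg P0 PD PZ PB p; rewrite -[p]lclassK.
elim: (repr p) => [u||s Ps t Pt|a t Pt|s Ps t Pt].
- exact: Pg.
- exact: P0.
- by rewrite lclass_add; exact: PD.
- by rewrite lclass_scale; exact: PZ.
- by rewrite lclass_bracket; exact: PB.
Qed.

End FreeLie.

Section Metabelian.
Variables (K : fieldType) (U : lmodType K).

(* [Metab] is M(U) and [metab_derived], or [Bmod] as a type, is B(U). *)
Definition second_derived : lieIdeal (FreeLie U) :=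
  commutator (derived (FreeLie U)) (derived (FreeLie U)).
Definition Metab : lieAlgType K := lie_quotient second_derived.

Definition metab_proj (x : FreeLie U) : Metab := lproj second_derived x.
HB.instance Definition _ := GRing.isLinear.Build K (FreeLie U) Metab *:%R
  metab_proj (@proj_is_linear K (FreeLie U) second_derived).

Definition metab_gen (u : U) : Metab := metab_proj (free_gen u).
Fact metab_gen_is_linear : linear metab_gen.
Proof. by move=> a u v; rewrite /metab_gen !linearP. Qed.
HB.instance Definition _ := GRing.isLinear.Build K U Metab *:%R metab_gen
  metab_gen_is_linear.

Definition metab_derived : lieIdeal Metab := derived Metab.
Definition Bmod : lmodType K := subspace metab_derived.

Fact metab_derived_lift x : x \in ideal_space metab_derived ->
  exists2 y, y \in ideal_space (derived (FreeLie U)) & metab_proj y = x.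
Proof.
pose P : set Metab := [set x | exists2 y, y \in ideal_space
  (derived (FreeLie U)) & metab_proj y = x].
have hP : is_submod P.
  split=> [|_ _ [y hy <-] [z hz <-]|a _ [y hy <-]].
  - by exists 0; rewrite ?rpred0 ?linear0.
  - by exists (y + z); rewrite ?rpredD ?linearD.
  - by exists (a *: y); rewrite ?rpredZ ?linearZ.
move=> hx; apply/(submod_ofP hP); move: x hx; apply: span_min.
move=> _ [x [y [_ _ ->]]]; apply/submod_ofP.
exists (lie (repr x) (repr y)); first by apply: lie_in_commutator; exact: mem_full.
by rewrite /metab_proj lproj_lie; congr lie; exact: projK.
Qed.

Lemma metab_derived_abelian x y : x \in ideal_space metab_derived ->
  y \in ideal_space metab_derived -> lie x y = 0.
Proof.
move=> /metab_derived_lift [x' hx <-] /metab_derived_lift [y' hy <-].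
transitivity (metab_proj (lie x' y')); first by rewrite /metab_proj lproj_lie.
by apply/proj_eq0; exact: lie_in_commutator.
Qed.

Lemma metab_split x :
  exists u c, c \in ideal_space metab_derived /\ x = metab_gen u + c.
Proof.
have h : forall y, exists u c, c \in ideal_space metab_derived /\
    metab_proj y = metab_gen u + c; last by rewrite -[x]projK; exact: h.
elim/free_lie_ind => [u||p q [u [c [Bc Ep]]]
    [v [d [Bd Eq]]]|a p [u [c [Bc Ep]]]|p q _ _].
- by exists u, 0; rewrite rpred0 addr0.
- by exists 0, 0; rewrite rpred0 addr0 !linear0.
- exists (u + v), (c + d); split; first by rewrite rpredD.
  by rewrite [LHS]linearD /= Ep Eq [X in _ = X + _]linearD addrACA.
- exists (a *: u), (a *: c); split; first by rewrite rpredZ.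
  by rewrite [LHS]linearZ /= Ep [X in _ = X + _]linearZ scalerDr.
- exists 0, (lie (metab_proj p) (metab_proj q)); split.
    by apply: lie_in_commutator; exact: mem_full.
  by rewrite linear0 add0r; exact: lproj_lie.
Qed.

Definition wbracket (v w : U) : Bmod :=
  insubspace (lie_in_commutator (mem_full (metab_gen v))
                                (mem_full (metab_gen w))).

Definition ad_gen (u : U) (b : Bmod) : Bmod :=
  insubspace (ideal_lie (metab_gen u) (valP b)).

Fixpoint term_act (t : sym_term U) (b : Bmod) : Bmod :=
  match t with
  | SGen u => ad_gen u b
  | SConst a => a *: b
  | SAdd s t => term_act s b + term_act t b
  | SMul s t => term_act s (term_act t b)
  end.

Lemma ad_gen_linear u : linear (ad_gen u).
Proof. by move=> a b c; apply: val_inj; rewrite /= lie_r. Qed.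

Lemma ad_gen_comm u v b : ad_gen u (ad_gen v b) = ad_gen v (ad_gen u b).
Proof.
apply: val_inj; rewrite /= lie_leibniz [X in X + _]metab_derived_abelian
  ?add0r //; last exact: valP.
by apply: lie_in_commutator; exact: mem_full.
Qed.

Lemma term_act_linear t : linear (term_act t).
Proof.
move=> c; elim: t => [u|a|s IHs t IHt|s IHs t IHt] b b' /=.
- exact: ad_gen_linear.
- by rewrite scalerDr !scalerA mulrC.
- by rewrite IHs IHt scalerDr addrACA.
- by rewrite IHt IHs.
Qed.

Lemma term_actD t b b' : term_act t (b + b') = term_act t b + term_act t b'.
Proof. by have := term_act_linear t 1 b b'; rewrite !scale1r. Qed.

Lemma term_actZ t a b : term_act t (a *: b) = a *: term_act t b.
Proof.
have t0 : term_act t 0 = 0.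
  by have := term_act_linear t (- 1) 0 0; rewrite scaler0 addr0 scaleN1r addNr.
by have := term_act_linear t a b 0; rewrite t0 !addr0.
Qed.

Lemma term_act_comm s t b :
  term_act s (term_act t b) = term_act t (term_act s b).
Proof.
elim: s t b => [u|a|s IHs s' IHs'|s IHs s' IHs'] t b /=.
- elim: t b => [v|a|t IHt t' IHt'|t IHt t' IHt'] b /=.
  + exact: ad_gen_comm.
  + exact: (term_actZ (SGen u)).
  + by rewrite -IHt -IHt'; exact: (term_actD (SGen u)).
  + by rewrite IHt IHt'.
- by rewrite term_actZ.
- by rewrite IHs IHs' term_actD.
- by rewrite IHs' IHs.
Qed.

Lemma term_actP s t : sym_rel s t -> term_act s =1 term_act t.
Proof.
elim=> {s t} //=.
- by move=> s t _ h b; rewrite h.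
- by move=> s t u _ h _ h' b; rewrite h h'.
- by move=> s s' t t' _ h _ h' b; rewrite h h'.
- by move=> s s' t t' _ h _ h' b; rewrite h' h.
- by move=> s t u b; rewrite addrA.
- by move=> s t b; rewrite addrC.
- by move=> t b; rewrite scale0r add0r.
- by move=> t b; rewrite scaleN1r addNr scale0r.
- by move=> s t b; exact: term_act_comm.
- by move=> t b; rewrite scale1r.
- by move=> a c b; rewrite scalerDl.
- by move=> a c b; rewrite scalerA.
- by move=> a u v b; apply: val_inj; rewrite /= linearP lie_l.
Qed.

Definition act (p : Sym U) (b : Bmod) : Bmod := term_act (repr p) b.

Lemma act_class t b : act (sclass t) b = term_act t b.
Proof. by apply/term_actP/sclassP; rewrite sclassK. Qed.

Lemma act_gen u b : val (act (sgen u) b) = lie (metab_gen u) (val b).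
Proof. by rewrite act_class. Qed.

Lemma act1 b : act 1 b = b.
Proof. by rewrite act_class /= scale1r. Qed.

Lemma actM p q b : act (p * q) b = act p (act q b).
Proof.
by rewrite -[p]sclassK -[q]sclassK -[_ * _]sclass_mul !act_class.
Qed.

Lemma act_l a p q b : act (a *: p + q) b = a *: act p b + act q b.
Proof.
rewrite -[p]sclassK -[q]sclassK.
have -> : a *: sclass (repr p) + sclass (repr q) =
    sclass (SAdd (SMul (SConst U a) (repr p)) (repr q)).
  by rewrite sclass_add sclass_mul.
by rewrite !act_class.
Qed.

Lemma act_r a p b c : act p (a *: b + c) = a *: act p b + act p c.
Proof. exact: term_act_linear. Qed.

Inductive lie_monomial : nat -> Metab -> Prop :=
| monomial_gen u : lie_monomial 1 (metab_gen u)
| monomial_lie m n x y : lie_monomial m x -> lie_monomial n y ->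
    lie_monomial (m + n) (lie x y).

Definition metab_deg (n : nat) : submodClosed Metab := span (lie_monomial n).

(* Degree [r] in [B(U)] is Lie degree [r + 2]. *)
Definition B_deg (r : nat) : submodClosed Bmod :=
  preim_submod (\val : {linear Bmod -> Metab}) (metab_deg r.+2).

(* [Z^2(U)] is the restricted graded dual of [B(U)]; the direct sum of the
    duals of the [B(U)_r] is encoded as the linear forms on [B(U)] that vanish
    on [B(U)_r] for all large [r], and its degree [r] part as the linear forms
    that vanish on [B(U)_s] for all [s <> r]. *)

Fact Z2_is_submod : is_submod [set Phi : Bmod -> K^o | linear Phi /\
  exists N, forall r, (N <= r)%N -> forall b, b \in B_deg r -> Phi b = 0].
Proof.
split=> [|f g [lf [m fm]] [lg [n gn]]|a f [lf [m fm]]].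
- split; first by move=> a x y; rewrite scaler0 addr0.
  by exists 0%N.
- split; first by move=> a x y; rewrite !fctE lf lg scalerDr addrACA.
  exists (maxn m n) => r; rewrite geq_max => /andP[mr nr] b hb.
  by rewrite fctE (fm r) // (gn r) // addr0.
- split.
    by move=> c x y; rewrite /= !fctE lf scalerDr !scalerA mulrC.
  by exists m => r mr b hb; rewrite fctE (fm r) // scaler0.
Qed.
Definition Z2 : submodClosed (Bmod -> K^o) := submod_of Z2_is_submod.

Fact Z2_deg_is_submod r : is_submod [set Phi : Bmod -> K^o | linear Phi /\
  forall s, s != r -> forall b, b \in B_deg s -> Phi b = 0].
Proof.
split=> [|f g [lf fm] [lg gn]|a f [lf fm]].
- by split=> // a x y; rewrite scaler0 addr0.
- split; first by move=> a x y; rewrite !fctE lf lg scalerDr addrACA.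
  by move=> s sr b hb; rewrite fctE (fm s) // (gn s) // addr0.
- split.
    by move=> c x y; rewrite /= !fctE lf scalerDr !scalerA mulrC.
  by move=> s sr b hb; rewrite fctE (fm s) // scaler0.
Qed.
Definition Z2_deg r : submodClosed (Bmod -> K^o) :=
  submod_of (Z2_deg_is_submod r).

Definition contraction (p : Sym U) (Phi : Bmod -> K^o) : Bmod -> K^o :=
  fun b => Phi (act p b).

Record gradedSubmodule := GradedSubmodule {
  gsub_space :> submodClosed (Bmod -> K^o);
  gsub_Z2 : {subset gsub_space <= Z2};
  gsub_contraction : forall p Phi,
    Phi \in gsub_space -> contraction p Phi \in gsub_space;
  gsub_graded : forall Phi, Phi \in gsub_space ->
    exists (n : nat) (Psi : nat -> Bmod -> K^o),
      (forall r, Psi r \in gsub_space /\ Psi r \in Z2_deg r)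
      /\ Phi = \sum_(r < n) Psi r }.

Definition degree_part (W : submodClosed (Bmod -> K^o)) (r : nat) :
  set (Bmod -> K^o) := [set Phi | Phi \in W /\ Phi \in Z2_deg r].

Definition wbracket_ext : ext2 U -> Bmod := ext2_lift wbracket.

Fact wbracket_l c v v' w :
  wbracket (c *: v + v') w = c *: wbracket v w + wbracket v' w.
Proof. by apply: val_inj; rewrite /= linearP lie_l. Qed.
Fact wbracket_r c v w w' :
  wbracket v (c *: w + w') = c *: wbracket v w + wbracket v w'.
Proof. by apply: val_inj; rewrite /= linearP lie_r. Qed.
Fact wbracket_alt v : wbracket v v = 0.
Proof. by apply: val_inj; exact: lie_xx. Qed.

HB.instance Definition _ := GRing.isLinear.Build K (ext2 U) Bmod *:%R
  wbracket_ext (ext2_lift_linear wbracket_l wbracket_r wbracket_alt).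

Lemma wbracket_extE v w : wbracket_ext (wedge v w) = wbracket v w.
Proof. exact: (ext2_liftE wbracket_l wbracket_r wbracket_alt). Qed.

Definition B_cover (r : nat) : tensor (Symr U r) (ext2 U) -> Bmod :=
  tensor_lift (fun p w => act (val p) (wbracket_ext w)).

Section Cover.
Variable r : nat.
Let cover_l c (p p' : Symr U r) w :
  act (val (c *: p + p')) (wbracket_ext w) =
  c *: act (val p) (wbracket_ext w) + act (val p') (wbracket_ext w).
Proof. by rewrite linearP act_l. Qed.
Let cover_r c (p : Symr U r) w w' : act (val p) (wbracket_ext (c *: w + w')) =
  c *: act (val p) (wbracket_ext w) + act (val p) (wbracket_ext w').
Proof. by rewrite linearP act_r. Qed.

HB.instance Definition _ := GRing.isLinear.Build K
  (tensor (Symr U r) (ext2 U)) Bmod *:%R (@B_cover r)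
  (tensor_lift_linear cover_l cover_r).

Lemma B_coverE (p : Symr U r) v w :
  B_cover (tens p (wedge v w)) = act (val p) (wbracket v w).
Proof.
by rewrite -wbracket_extE; exact: (tensor_liftE cover_l cover_r).
Qed.
End Cover.

(* [(Sym^r U)^* (x) Lambda^2 U^*] is identified with the dual of
   [Sym^r U (x) Lambda^2 U]. On forms of degree [r] this is the embedding of
   [Z^2(U)_r]; it kills [Z^2(U)_s] for [s <> r], so that applied to any form it
   embeds its degree [r] component. *)
Definition embed (r : nat) (Phi : Bmod -> K^o) :
  tensor (Symr U r) (ext2 U) -> K^o := Phi \o @B_cover r.

Section Perp.
Variable W : gradedSubmodule.

Definition perp_set : set Metab := [set x | exists2 b : Bmod, val b = x &
  forall Phi, Phi \in gsub_space W -> Phi b = 0].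

Let W_linear Phi : Phi \in gsub_space W -> linear Phi.
Proof. by move=> /gsub_Z2 /submod_ofP []. Qed.

Fact perp_is_submod : is_submod perp_set.
Proof.
split=> [|_ _ [b <- hb] [c <- hc]|a _ [b <- hb]].
- exists 0 => // Phi hPhi; have := W_linear hPhi (- 1) 0 0.
  by rewrite scaler0 addr0 scaleN1r addNr.
- exists (b + c) => // Phi hPhi; have := W_linear hPhi 1 b c.
  by rewrite !scale1r hb // hc // addr0.
- exists (a *: b) => // Phi hPhi; have := W_linear hPhi a b 0.
  have := W_linear hPhi (- 1) 0 0.
  by rewrite scaler0 addr0 scaleN1r addNr => ->; rewrite !addr0 hb // scaler0.
Qed.

Fact perp_lie x y :
  y \in submod_of perp_is_submod -> lie x y \in submod_of perp_is_submod.
Proof.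
move=> /submod_ofP [b <- hb]; apply/submod_ofP.
have [u [c [Bc ->]]] := metab_split x.
exists (act (sgen u) b).
  by rewrite act_gen lieDl (metab_derived_abelian Bc (valP b)) addr0.
by move=> Phi hPhi; exact: (hb _ (gsub_contraction (sgen u) hPhi)).
Qed.

Definition perp : lieIdeal Metab := LieIdeal perp_lie.

Definition gW : lieAlgType K := lie_quotient perp.

Definition gW_proj (x : Metab) : gW := lproj perp x.
HB.instance Definition _ := GRing.isLinear.Build K Metab gW *:%R gW_proj
  (@proj_is_linear K Metab perp).

Lemma gW_proj_lie x y : gW_proj (lie x y) = lie (gW_proj x) (gW_proj y).
Proof. exact: lproj_lie. Qed.

End Perp.

End Metabelian.

Section LowerCentralTensors.
Variables (K : fieldType) (L : lieAlgType K).

Definition abelianization : lmodType K := quotient (lcs L 2).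

Definition abproj (x : L) : abelianization := proj (lcs L 2) x.
Fact abproj_is_linear : linear abproj.
Proof. exact: (@proj_is_linear K L (lcs L 2)). Qed.
HB.instance Definition _ := GRing.isLinear.Build K L abelianization *:%R abproj
  abproj_is_linear.

Definition lcs_gr (j : nat) : lmodType K :=
  subquotient (lcs L j) (lcs L j.+1).

Definition gr_proj (j : nat) (x : subspace (lcs L j)) : lcs_gr j :=
  subproj (lcs L j.+1) x.
Fact gr_proj_is_linear j : linear (@gr_proj j).
Proof. exact: (@subproj_is_linear K L (lcs L j) (lcs L j.+1)). Qed.

Definition lc_value (r : nat) (us : r.-tuple L) (v w : L) : lcs_gr r.+2 :=
  gr_proj (insubspace (ad_iter_lcs us v w)).

Definition lc_source (r : nat) : lmodType K :=
  tensor (Symr abelianization r) (ext2 abelianization).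

Definition is_lc_tensor (r : nat)
    (T : lc_source r -> lcs_gr r.+2) : Prop :=
  forall (us : r.-tuple L) (v w : L),
    T (tens (sym_prod (map_tuple abproj us)) (wedge (abproj v) (abproj w)))
    = lc_value us v w.

End LowerCentralTensors.

Section Transport.
Variables (K : fieldType) (U : lmodType K) (W : gradedSubmodule U).

Definition theta (u : U) : abelianization (gW W) :=
  abproj (gW_proj W (metab_gen u)).

Fact theta_is_linear : linear theta.
Proof.
move=> a u v; rewrite /theta metab_gen_is_linear.
rewrite (linearP (gW_proj W)).
exact: abproj_is_linear.
Qed.
HB.instance Definition _ := GRing.isLinear.Build K U (abelianization (gW W))
  *:%R theta theta_is_linear.

Definition transport (r : nat) :
    tensor (Symr U r) (ext2 U) -> lc_source (gW W) r :=
  tensor_map (symr_map theta (r := r)) (ext2_map theta).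

(* The image of the transpose of [T], transported to [U]. *)
Definition im_transpose (r : nat) (Y : lmodType K)
    (T : {linear lc_source (gW W) r -> Y}) :
    set (tensor (Symr U r) (ext2 U) -> K^o) :=
  [set F | exists l : {linear Y -> K^o}, F = l \o T \o @transport r].

Definition is_top_degree (d : nat) : Prop :=
  (exists2 Phi, degree_part W d Phi & Phi != 0) /\
  (forall r, (exists2 Phi, degree_part W r Phi & Phi != 0) -> (r <= d)%N).

End Transport.

Arguments embed {K U} r Phi _.

(* Main.v *)
From HB Require Import structures.
Require Import Defs.
From mathcomp Require Import all_boot all_order all_algebra.
From mathcomp Require Import boolp classical_sets functions.

(* Up to the identification theta of U with the abelianization, T^(r) is the
   composite of the cover Sym^r U (x) Lambda^2 U -> B(U)_r with the projection
   B(U) -> B(U) / perp(W). Every transposed form l o T^(r) therefore vanishes on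
   the common kernel of the forms embed r Phi, Phi in W; since W is spanned by
   finitely many forms, l o T^(r) is itself of this kind, and the homogeneous
   components of Phi other than W_r are killed by embed r. Conversely a form of
   degree r in W descends to gamma_(r+2) / gamma_(r+3), because
   gamma_(k+2)(M(U)) is spanned by the products u_1 ... u_n . [v, w] with
   n >= k. *)

Set Implicit Arguments.
Unset Strict Implicit.
Unset Printing Implicit Defensive.

Import GRing.Theory.
Local Open Scope ring_scope.
Local Open Scope classical_set_scope.

(** * Linear maps, and finite spans of linear forms *)

Section LinearFunctions.
Variables (K : fieldType) (V W : lmodType K) (f : V -> W).
Hypothesis lin_f : linear f.

(** Forms and actions are bare functions here, while lemmas such as [linearD] want bundled maps; the
    equation permits rewriting both ways. *)
Lemma linear_pack : exists g : {linear V -> W}, g = f :> (V -> W).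
Proof.
pose g : {linear V -> W} := HB.pack f (GRing.isLinear.Build K V W *:%R f lin_f).
by exists g.
Qed.

Lemma kernel_is_submod : is_submod [set x | f x = 0].
Proof.
have [g gE] := linear_pack; rewrite -gE.
split=> /= [|x y gx gy|a x gx]; first exact: linear0.
  by rewrite linearD gx gy addr0.
by rewrite linearZ /= gx scaler0.
Qed.

End LinearFunctions.

Lemma linear_inverse (K : fieldType) (V W : lmodType K) (f : {linear V -> W}) :
  bijective f -> exists g : {linear W -> V}, cancel f g /\ cancel g f.
Proof.
case=> g fK gK.
have lin_g : linear g.
  by move=> a x y; apply: (can_inj fK); rewrite linearP !gK.
by have [h hE] := linear_pack lin_g; exists h; rewrite hE.
Qed.

Lemma linear_form_span (K : fieldType) (X : lmodType K) (s : seq (X -> K^o))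
    (F : X -> K^o) :
  (forall f, f \in s -> linear f) -> linear F ->
  (forall x, (forall f, f \in s -> f x = 0) -> F x = 0) ->
  F \in Defs.span [set f | f \in s].
Proof.
have widen (f g : X -> K^o) s' : g \in Defs.span [set h | h \in s'] ->
    g \in Defs.span [set h | h \in f :: s'].
  apply: span_min => h hs; apply: mem_span => /=.
  by rewrite inE; apply/orP; right.
elim: s F => [|f s IH] F lin_s lin_F kerF.
  suff -> : F = 0 by exact: rpred0.
  by apply/funext => x; exact: kerF.
have lin_s' g : g \in s -> linear g.
  by move=> gs; apply: lin_s; rewrite inE gs orbT.
have [[x0 [sx0 fx0]]|no] := pselect (exists x0, (forall g, g \in s -> g x0 = 0)
    /\ f x0 != 0); last first.
  apply/widen/IH => // x sx; apply: kerF => g; rewrite inE => /orP[/eqP ->|].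
    by apply: contra_notP no => /eqP fx; exists x.
  exact: sx.
have [f' f'E] := linear_pack (lin_s f (mem_head _ _)).
have [F' F'E] := linear_pack lin_F.
(* This constant makes [F - c *: f] vanish at [x0]. *)
pose c : K := F x0 / f x0.
rewrite -(subrK (c *: f) F) rpredD //; last first.
  by apply: rpredZ; apply: mem_span; exact: mem_head.
apply/widen/IH => // [|x sx].
  by rewrite -f'E -F'E; exact: (linearP (F' \- (c \*: f'))).
(* The projection of [x] along [x0] to the kernel of [f] stays in the common kernel of [s], so
   [kerF] applies to it. *)
have : F (x - (f x / f x0) *: x0) = 0.
  apply: kerF => g; rewrite inE => /orP[/eqP ->|gs].
    rewrite -f'E linearB linearZ /= f'E -[_ *: _]/(_ * _).
    by rewrite divfK ?subrr.
  have [g' g'E] := linear_pack (lin_s' _ gs).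
  by rewrite -g'E linearB linearZ /= g'E (sx _ gs) (sx0 _ gs) scaler0 subr0.
rewrite -F'E linearB linearZ /= F'E => /eqP; rewrite subr_eq0 => /eqP Fx.
rewrite !fctE Fx; apply/eqP; rewrite subr_eq0; apply/eqP.
change (f x / f x0 * F x0 = F x0 / f x0 * f x).
by rewrite mulrC mulrA mulrAC.
Qed.

Lemma preim_submodP (K : fieldType) (V W : lmodType K) (f : {linear V -> W})
    (S : submodClosed W) x : x \in preim_submod f S <-> f x \in S.
Proof. exact: (submod_ofP (preim_is_submod f S)). Qed.

(** * Generators of [Sym^r (x) Lambda^2] and induction on them *)

Section Generation.
Variables (K : fieldType) (V : lmodType K).

Lemma ext2_ind (S : submodClosed (ext2 V)) :
  (forall v w, wedge v w \in S) -> forall x, x \in S.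
Proof.
move=> h x; rewrite -[x]projK.
apply/(preim_submodP (@proj _ _ _)); apply: tensor_ind => v w.
by apply/preim_submodP; exact: h.
Qed.

(** Elements of [Symr V r] carry a membership proof, so the span argument is run in [Sym V] on the
    image of [S]. *)
Lemma symr_ind r (S : submodClosed (Symr V r)) :
  (forall us : r.-tuple V, sym_prod us \in S) -> forall p, p \in S.
Proof.
move=> h [p hp].
have sub : is_submod [set p : Sym V | exists2 q, q \in S & val q = p].
  split=> [|_ _ [p1 S1 <-] [p2 S2 <-]|a _ [q Sq <-]].
  - by exists 0; rewrite ?rpred0.
  - by exists (p1 + p2); rewrite ?rpredD.
  - by exists (a *: q); rewrite ?rpredZ.
have : p \in submod_of sub.
  move: p hp; apply: span_min => _ [us _ ->]; apply/submod_ofP.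
  by exists (sym_prod us).
move=> /submod_ofP [q Sq qp].
by have -> : exist _ p hp = q by exact/val_inj/esym.
Qed.

Lemma symr_ext2_ind r (S : submodClosed (tensor (Symr V r) (ext2 V))) :
  (forall (us : r.-tuple V) v w, tens (sym_prod us) (wedge v w) \in S) ->
  forall x, x \in S.
Proof.
move=> h; apply: tensor_ind => p w.
have lin_l (y : ext2 V) : linear (fun q : Symr V r => tens q y).
  by move=> a q q'; exact: tens_l.
have lin_r q : linear (tens q : ext2 V -> tensor (Symr V r) (ext2 V)).
  by move=> a y y'; exact: tens_r.
have [f fE] := linear_pack (lin_l w).
have : p \in preim_submod f S.
  apply: symr_ind => us; apply/preim_submodP; rewrite fE.
  have [g gE] := linear_pack (lin_r (sym_prod us)).
  have : w \in preim_submod g S.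
    by apply: ext2_ind => v v'; apply/preim_submodP; rewrite gE.
  by rewrite preim_submodP gE.
by rewrite preim_submodP fE.
Qed.

Lemma symr_ext2_eq r (Y : lmodType K)
    (f g : {linear tensor (Symr V r) (ext2 V) -> Y}) :
  (forall (us : r.-tuple V) v w,
    f (tens (sym_prod us) (wedge v w)) = g (tens (sym_prod us) (wedge v w))) ->
  f =1 g.
Proof.
move=> h x.
have ker := kernel_is_submod (linearP (f \- g)).
have : x \in submod_of ker.
  apply: symr_ext2_ind => us v w; apply/submod_ofP => /=.
  by rewrite h subrr.
by move=> /submod_ofP /= /eqP; rewrite subr_eq0 => /eqP.
Qed.

End Generation.

Lemma symr_map_prod (K : fieldType) (V W : lmodType K) (f : {linear V -> W})
    r (us : r.-tuple V) :
  symr_map f (sym_prod us) = sym_prod (map_tuple f us).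
Proof.
apply: val_inj; rewrite /= big_map; elim: (us : seq V) => [|u s IH].
  by rewrite !big_nil sym_map1.
by rewrite !big_cons sym_mapM sym_map_gen IH.
Qed.

Lemma tensor_map_prod (K : fieldType) (V W : lmodType K)
    (f : {linear V -> W}) r (us : r.-tuple V) v w :
  tensor_map (symr_map f (r := r)) (ext2_map f)
    (tens (sym_prod us) (wedge v w))
  = tens (sym_prod (map_tuple f us)) (wedge (f v) (f w)).
Proof. by rewrite tensor_mapE /= symr_map_prod ext2_mapE. Qed.

(** * Lower central series, and the tensors of a metabelian Lie algebra *)

Section LowerCentralSeries.
Variables (K : fieldType) (L : lieAlgType K).

Lemma lcs_bracket j (x y : L) : y \in ideal_space (lcs L j.+1) ->
  lie x y \in ideal_space (lcs L j.+2).
Proof. by move=> Ly; apply: lie_in_commutator => //; exact: mem_full. Qed.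

Lemma lcs_sub2 j : {subset ideal_space (lcs L j.+2) <= ideal_space (lcs L 2)}.
Proof.
apply: span_min => _ [y [z [_ _ ->]]].
by apply: lie_in_commutator; exact: mem_full.
Qed.

Lemma ad_iter_linear (us : seq L) : linear (ad_iter us).
Proof.
move=> a x y; elim: us x y => [//|u us IH] x y.
by rewrite /= -IH lie_r.
Qed.

Lemma ad_iter_mem_lcs (us : seq L) j x : x \in ideal_space (lcs L j.+1) ->
  ad_iter us x \in ideal_space (lcs L (size us + j).+1).
Proof.
elim: us j x => [//|u us IH] j x Lx; rewrite [size _]/= addSnnS; apply: IH.
exact: lcs_bracket.
Qed.

Lemma abproj_eq (x y : L) :
  abproj x = abproj y <-> x - y \in ideal_space (lcs L 2).
Proof. exact: (proj_eq (lcs L 2)). Qed.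

Lemma abproj_surj (q : abelianization L) : exists x, abproj x = q.
Proof. by exists (repr q); exact: projK. Qed.

Lemma gr_proj_eq j (x y : subspace (lcs L j)) :
  gr_proj x = gr_proj y <-> val x - val y \in ideal_space (lcs L j.+1).
Proof.
by rewrite -raddfB -(preim_submodP (\val : {linear _ -> L})); exact: proj_eq.
Qed.

Lemma gr_proj_inj j : (forall x, x \in ideal_space (lcs L j.+1) -> x = 0) ->
  injective (@gr_proj K L j).
Proof.
move=> L0 x y /gr_proj_eq /L0 /eqP.
by rewrite subr_eq0 => /eqP; exact: val_inj.
Qed.

(** Lifts through [abproj] always exist, so the prescribed values cover all generating tensors. *)
Lemma is_lc_tensor_uniq r (T T' : {linear lc_source L r -> lcs_gr L r.+2}) :
  is_lc_tensor T -> is_lc_tensor T' -> T' =1 T.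
Proof.
move=> hT hT'; apply: symr_ext2_eq => us v w.
have [v' <-] := abproj_surj v; have [w' <-] := abproj_surj w.
have -> : us = map_tuple (@abproj K L) (map_tuple repr us).
  apply: val_inj; rewrite /= -map_comp -[LHS]map_id; apply: eq_map => q /=.
  by rewrite [RHS]projK.
by rewrite hT hT'.
Qed.

Hypothesis metabelian : forall x y, x \in ideal_space (lcs L 2) ->
  y \in ideal_space (lcs L 2) -> lie x y = 0.

(** By the Jacobi identity the two sides differ by [[[u, v], x]], a bracket of two elements of
    gamma_2. *)
Lemma metabelian_lie_comm u v x : x \in ideal_space (lcs L 2) ->
  lie u (lie v x) = lie v (lie u x).
Proof.
move=> Lx; rewrite lie_leibniz [X in X + _]metabelian ?add0r //.
by apply: lcs_bracket; exact: mem_full.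
Qed.

Lemma ad_iter_lie us u x : x \in ideal_space (lcs L 2) ->
  ad_iter us (lie u x) = lie u (ad_iter us x).
Proof.
elim: us x => [//|v us IH] x Lx /=.
by rewrite metabelian_lie_comm // IH //; exact/(@lcs_sub2 1)/lcs_bracket.
Qed.

Lemma ad_iter_comm us vs x : x \in ideal_space (lcs L 2) ->
  ad_iter us (ad_iter vs x) = ad_iter vs (ad_iter us x).
Proof.
elim: us x => [//|u us IH] x Lx /=.
by rewrite -ad_iter_lie // IH //; exact/(@lcs_sub2 1)/lcs_bracket.
Qed.

Lemma ad_iter_perm us us' x : perm_eq us us' -> x \in ideal_space (lcs L 2) ->
  ad_iter us x = ad_iter us' x.
Proof.
move=> eq_us Lx; pose P s := ad_iter us x = ad_iter s x.
(* Permutations are generated by exchanging the two leading blocks of a list, so it suffices that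
   the iterated brackets of two blocks commute. *)
apply: (@catCA_perm_ind _ P) eq_us (erefl _) => s1 s2 s3; rewrite /P => ->.
rewrite /ad_iter !foldl_cat -!/(ad_iter _ _); congr ad_iter.
exact: ad_iter_comm.
Qed.

(** Entries with the same class differ by an element of gamma_2, whose bracket with gamma_2 is zero.
    Hence equality holds exactly, before any reduction modulo the next term. *)
Lemma ad_iter_abproj us us' x : map (@abproj K L) us = map (@abproj K L) us' ->
  x \in ideal_space (lcs L 2) -> ad_iter us x = ad_iter us' x.
Proof.
elim: us us' x => [|u us IH] [|u' us'] x //= [/abproj_eq uu' eq_us] Lx.
have -> : lie u x = lie u' x.
  by apply/eqP; rewrite -subr_eq0 -lieNl -lieDl metabelian.
by apply: IH => //; exact/(@lcs_sub2 1)/lcs_bracket.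
Qed.

Lemma lie_mem_lcs2 x y : lie x y \in ideal_space (lcs L 2).
Proof. by apply: lcs_bracket; exact: mem_full. Qed.

(** Replacing the outer entries changes nothing. Replacing [v] and [w] changes [lie v w] by an
    element of gamma_3, hence the iterated bracket by one of gamma_(r+3), which is zero in
    [lcs_gr]. *)
Lemma lc_value_abproj r (us us' : r.-tuple L) (v v' w w' : L) :
  map_tuple (@abproj K L) us = map_tuple (@abproj K L) us' ->
  abproj v = abproj v' -> abproj w = abproj w' ->
  lc_value us v w = lc_value us' v' w'.
Proof.
move=> /(congr1 val) /= eq_us /abproj_eq vv' /abproj_eq ww'.
case: (gr_proj_eq (insubspace (ad_iter_lcs us v w))
  (insubspace (ad_iter_lcs us' v' w'))) => _; apply.
rewrite /= (ad_iter_abproj eq_us) ?lie_mem_lcs2 //.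
have -> : lie v w = lie v' w' + (lie v (w - w') - lie w' (v - v')).
  by rewrite (lieC w') opprK lieDr lieNr lieDl lieNl !addrA subrK addrC addKr.
have [f fE] := linear_pack (ad_iter_linear us'); rewrite -fE.
rewrite linearD addrAC subrr add0r fE.
have := @ad_iter_mem_lcs us' 2 (lie v (w - w') - lie w' (v - v')).
rewrite size_tuple addn2; apply.
by apply: submodB; exact: lcs_bracket.
Qed.

Lemma lc_value_perm r (us us' : r.-tuple L) (v w : L) :
  perm_eq us us' -> lc_value us v w = lc_value us' v w.
Proof.
move=> eq_us; rewrite /lc_value; congr gr_proj; apply: val_inj => /=.
exact/ad_iter_perm/lie_mem_lcs2.
Qed.

End LowerCentralSeries.

Lemma lcs_lproj (K : fieldType) (L : lieAlgType K) (I : lieIdeal L) j q :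
  q \in ideal_space (lcs (lie_quotient I) j) ->
  exists2 x, x \in ideal_space (lcs L j) & lproj I x = q.
Proof.
have surj (p : lie_quotient I) : lproj I (repr p) = p by exact: projK.
(* Indices 0 and 1 both give the whole algebra, since [lcs] uses the predecessor; [j.+2] is the
   first true commutator. *)
elim: j q => [|[|j] IH] q; try by exists (repr q); rewrite ?surj ?mem_full.
have sub : is_submod [set q | exists2 x, x \in ideal_space (lcs L j.+2)
    & lproj I x = q].
  split=> [|_ _ [x Lx <-] [y Ly <-]|a _ [x Lx <-]].
  - by exists 0; rewrite ?rpred0 ?linear0.
  - by exists (x + y); rewrite ?rpredD ?linearD.
  - by exists (a *: x); rewrite ?rpredZ ?linearZ.
move=> Lq; apply/(submod_ofP sub); move: q Lq; apply: span_min.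
move=> _ [p [_ [_ /IH [y Ly <-] ->]]]; apply/submod_ofP.
exists (lie (repr p) y); first exact: lcs_bracket.
by rewrite lproj_lie surj.
Qed.

Lemma lproj_mem_lcs (K : fieldType) (L : lieAlgType K) (I : lieIdeal L) j x :
  x \in ideal_space (lcs L j) ->
  lproj I x \in ideal_space (lcs (lie_quotient I) j).
Proof.
elim: j x => [|[|j] IH] x; try by rewrite !mem_full.
move=> Lx; apply/(preim_submodP (lproj I)); apply: (span_min _ Lx).
move=> _ [y [z [_ hz ->]]]; apply/preim_submodP.
rewrite -[X in X \in _]/(lproj I _) lproj_lie.
by apply: lcs_bracket; exact: IH.
Qed.

(** * The filtration of [B(U)] by internal degree *)

Section Metabelian.
Variables (K : fieldType) (U : lmodType K).

(** The part of degree at least [k], given by explicit generators instead of a sum of the [B_deg]: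
    brackets produce such generators, and linear forms are tested on them. *)
Definition B_ge (k : nat) : submodClosed (Bmod U) :=
  Defs.span [set b | exists us v w, (k <= size us)%N
    /\ b = act (\prod_(u <- us) sgen u) (wbracket v w)].

Lemma act_linear (p : Sym U) : linear (act p).
Proof. by move=> a b c; exact: act_r. Qed.

Lemma val_act_prod (us : seq U) (b : Bmod U) :
  val (act (\prod_(u <- us) sgen u) b)
  = ad_iter (map (@metab_gen K U) us) (val b).
Proof.
elim: us b => [|u us IH] b; first by rewrite big_nil act1.
(* [ad_iter] applies the head of the list first, the product applies it last; commutativity of
   [Sym U] moves it inside. *)
by rewrite big_cons mulrC actM IH act_gen.
Qed.

Lemma act_prod_B_deg (us : seq U) (v w : U) :
  act (\prod_(u <- us) sgen u) (wbracket v w) \in B_deg U (size us).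
Proof.
apply/preim_submodP; rewrite /= val_act_prod -addn2; apply: mem_span.
have : lie_monomial 2 (val (wbracket v w)).
  exact: (monomial_lie (monomial_gen v) (monomial_gen w)).
elim: us 2%N (val _) => [//|u us IH] n x hx.
rewrite /= addSnnS; apply: IH; rewrite -add1n.
exact: monomial_lie (monomial_gen u) hx.
Qed.

Lemma act_gen_B_ge k (u : U) b :
  b \in B_ge k -> act (sgen u) b \in B_ge k.+1.
Proof.
have [f fE] := linear_pack (act_linear (sgen u)).
rewrite -fE -preim_submodP; apply: span_min => _ [us [v [w [kus ->]]]].
apply/preim_submodP; rewrite fE -actM; apply: mem_span.
by exists (u :: us), v, w; rewrite big_cons.
Qed.

Lemma B_ge_sub k l : (l <= k)%N -> {subset B_ge k <= B_ge l}.
Proof.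
move=> lk; apply: span_min => _ [us [v [w [kus ->]]]]; apply: mem_span.
by exists us, v, w; rewrite (leq_trans lk).
Qed.

(** Expanding the bracket gives [[u, v] + u . d - v . c + [c, d]], and the last term vanishes
    because [B(U)] is abelian. *)
Lemma lie_gen_B_ge (u v : U) (c d : Bmod U) : c \in B_ge 0 -> d \in B_ge 0 ->
  exists2 b, b \in B_ge 0
    & val b = lie (metab_gen u + val c) (metab_gen v + val d).
Proof.
move=> Bc Bd; exists (wbracket u v + (act (sgen u) d - act (sgen v) c)).
  rewrite rpredD //; last first.
    by apply: submodB; apply: (@B_ge_sub 1) => //; exact: act_gen_B_ge.
  by apply: mem_span; exists [::], u, v; rewrite big_nil act1.
rewrite lieDl !lieDr (metab_derived_abelian (valP c) (valP d)) addr0.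
by rewrite /= !act_gen (lieC (val c)) addrA.
Qed.

Lemma metab_split_B_ge (x : Metab U) :
  exists u b, b \in B_ge 0 /\ x = metab_gen u + val b.
Proof.
have h y : exists u b, b \in B_ge 0 /\ metab_proj y = metab_gen u + val b;
  last by rewrite -[x]projK; exact: h.
elim/free_lie_ind: y => [u||p q [u [c [Bc Ep]]] [v [d [Bd Eq]]]
    |a p [u [c [Bc Ep]]]|p q [u [c [Bc Ep]]] [v [d [Bd Eq]]]].
- by exists u, 0; rewrite rpred0 addr0.
- by exists 0, 0; rewrite rpred0 addr0 !linear0.
- exists (u + v), (c + d); split; first by rewrite rpredD.
  by rewrite [LHS]linearD /= Ep Eq [X in _ = X + _]linearD addrACA.
- exists (a *: u), (a *: c); split; first by rewrite rpredZ.
  by rewrite [LHS]linearZ /= Ep [X in _ = X + _]linearZ scalerDr.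
- have [b Bb bE] := lie_gen_B_ge u v Bc Bd; exists 0, b; split=> //.
  rewrite linear0 add0r bE -Ep -Eq; exact: lproj_lie.
Qed.

(** In the inductive step only the generator part [u] of the left factor acts on [B(U)], and it
    raises the degree by one. *)
Lemma lcs_metab_B_ge k x : x \in ideal_space (lcs (Metab U) k.+2) ->
  exists2 b, b \in B_ge k & val b = x.
Proof.
have sub j : is_submod [set x | exists2 b, b \in B_ge j & val b = x].
  split=> [|_ _ [b hb <-] [c hc <-]|a _ [b hb <-]].
  - by exists 0; rewrite ?rpred0.
  - by exists (b + c); rewrite ?rpredD.
  - by exists (a *: b); rewrite ?rpredZ.
suff h j : {subset ideal_space (lcs (Metab U) j.+2) <= submod_of (sub j)}.
  by move=> /h /submod_ofP.
elim: j => [|j IH]; apply: span_min => _ [y [z [_ hz ->]]]; apply/submod_ofP.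
  have [u [c [Bc ->]]] := metab_split_B_ge y.
  have [v [d [Bd ->]]] := metab_split_B_ge z.
  exact: lie_gen_B_ge.
have [u [c [Bc ->]]] := metab_split_B_ge y.
have /submod_ofP [d Bd <-] := IH _ hz.
exists (act (sgen u) d); first exact: act_gen_B_ge.
by rewrite act_gen lieDl (metab_derived_abelian (valP c) (valP d)) addr0.
Qed.

(** The term [lcs 2] is by conversion the derived algebra, the carrier of [Bmod], so the products
    span all of [B(U)]. *)
Lemma B_ge0 b : b \in B_ge 0.
Proof. by have [c Bc /val_inj <-] := lcs_metab_B_ge (k := 0) (valP b). Qed.

Lemma form_B_ge (Phi : Bmod U -> K^o) k : linear Phi ->
  (forall r, (k <= r)%N -> forall b, b \in B_deg U r -> Phi b = 0) ->
  forall b, b \in B_ge k -> Phi b = 0.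
Proof.
move=> lin_Phi Phi0; apply: linear_span0 => // _ [us [v [w [kus ->]]]].
exact: (Phi0 _ kus _ (act_prod_B_deg us v w)).
Qed.

Lemma B_cover_prod r (us : r.-tuple U) v w :
  B_cover (tens (sym_prod us) (wedge v w))
  = act (\prod_(u <- us) sgen u) (wbracket v w).
Proof. exact: B_coverE. Qed.

Lemma B_cover_deg r (x : tensor (Symr U r) (ext2 U)) : B_cover x \in B_deg U r.
Proof.
rewrite -preim_submodP; apply: symr_ext2_ind => us v w.
rewrite preim_submodP /= B_cover_prod.
by have := act_prod_B_deg us v w; rewrite size_tuple.
Qed.

(** A form on [B(U)] is determined by its values on the products spanning it, and a product with [n]
    factors is in the image of the cover of degree [n]. *)
Lemma embed_inj (Phi Psi : Bmod U -> K^o) : linear Phi -> linear Psi ->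
  (forall r, embed r Phi = embed r Psi) -> Phi = Psi.
Proof.
move=> lin_Phi lin_Psi eq_embed; apply/funext => b.
have [f fE] := linear_pack lin_Phi; have [g gE] := linear_pack lin_Psi.
apply/eqP; rewrite -subr_eq0 -fE -gE; apply/eqP.
apply: (linear_span0 (linearP (f \- g))) (B_ge0 b).
move=> _ [us [v [w [_ ->]]]] /=; apply/eqP; rewrite subr_eq0 fE gE; apply/eqP.
have := congr1 (@^~ (tens (sym_prod (in_tuple us)) (wedge v w)))
  (eq_embed (size us)).
by rewrite /embed /= B_cover_prod.
Qed.

Lemma embed_deg0 r s Phi : Phi \in Z2_deg U s -> s != r -> embed r Phi = 0.
Proof.
move=> /submod_ofP [_ Phi0] sr; apply/funext => x.
by apply: (Phi0 r); rewrite ?B_cover_deg // eq_sym.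
Qed.

Lemma free_gen_derived_eq0 (u : U) :
  free_gen u \in ideal_space (derived (FreeLie U)) -> u = 0.
Proof.
(* Killing every bracket retracts the free Lie algebra onto its generators. *)
pose fix ev (t : lie_term U) : U := match t with
  | LGen u => u
  | LZero => 0
  | LAdd s t => ev s + ev t
  | LScale a t => a *: ev t
  | LBracket _ _ => 0
  end.
have evP s t : lie_rel s t -> ev s = ev t.
  elim=> //= *; rewrite ?(scaler0, addr0, scaleN1r, addNr, add0r, scalerA,
    scale1r, scalerDr, scalerDl, addrA) //; try congruence.
  exact: addrC.
pose E (p : FreeLie U) := ev (repr p).
have EE t : E (lclass t) = ev t by apply/evP/lclassP; rewrite lclassK.
have lin_E : linear E.
  move=> a p q; rewrite -[p]lclassK -[q]lclassK.
  by rewrite -[_ *: lclass _]lclass_scale -[_ + lclass _]lclass_add !EE.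
move=> hu; rewrite -[u](EE (LGen u)); apply: (linear_span0 lin_E) hu.
move=> _ [p [q [_ _ ->]]]; rewrite -[p]lclassK -[q]lclassK.
by rewrite -[lie _ _]lclass_bracket EE.
Qed.

(** A lift of [metab_gen u] to the derived algebra of the free Lie algebra differs from [free_gen u]
    by an element of the second derived algebra, which lies in the first. *)
Lemma metab_gen_derived_eq0 (u : U) :
  metab_gen u \in ideal_space (metab_derived U) -> u = 0.
Proof.
move=> /metab_derived_lift [y hy /proj_eq yu]; apply: free_gen_derived_eq0.
rewrite -[free_gen u](subKr y); apply: submodB => //.
apply: (span_min _ yu) => _ [a [b [_ _ ->]]].
by apply: lie_in_commutator; exact: mem_full.
Qed.

End Metabelian.

(** * The algebra [gW W], its tensors and their transposes *)

Section QuotientAlgebra.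
Variables (K : fieldType) (U : lmodType K) (W : gradedSubmodule U).

Let W_linear Phi : Phi \in gsub_space W -> linear Phi.
Proof. by move=> /gsub_Z2 /submod_ofP []. Qed.

Lemma gW_proj_val_eq0 (b : Bmod U) : gW_proj W (val b) = 0 <->
  forall Phi, Phi \in gsub_space W -> Phi b = 0.
Proof.
split=> [/proj_eq0 /submod_ofP [c /val_inj ->] //|hb].
by apply/proj_eq0/submod_ofP; exists b.
Qed.

Lemma lcs_gW_lift k q : q \in ideal_space (lcs (gW W) k.+2) ->
  exists2 b, b \in B_ge U k & gW_proj W (val b) = q.
Proof. by move=> /lcs_lproj [_ /lcs_metab_B_ge [b hb <-] <-]; exists b. Qed.

Lemma gW_metabelian (x y : gW W) : x \in ideal_space (lcs (gW W) 2) ->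
  y \in ideal_space (lcs (gW W) 2) -> lie x y = 0.
Proof.
move=> /lcs_gW_lift [b _ <-] /lcs_gW_lift [c _ <-].
by rewrite -gW_proj_lie (metab_derived_abelian (valP b) (valP c)) linear0.
Qed.

(** Surjectivity comes from splitting [M(U)] into generators and [B(U)]. For injectivity, [perp W]
    lies in [B(U)], so any [u] in the kernel has [metab_gen u] in the derived algebra. *)
Lemma theta_bijective : bijective (theta W).
Proof.
suff /choice [g gK] : forall q, exists u, theta W u = q.
  exists g => // u; apply/eqP; rewrite -subr_eq0; apply/eqP.
  apply: metab_gen_derived_eq0.
  have /proj_eq : theta W (g (theta W u)) = theta W u by exact: gK.
  rewrite -raddfB -raddfB => /lcs_gW_lift [b _].
  move=> /proj_eq /submod_ofP [c [cE _]].
  by rewrite -[metab_gen _](subKr (val b)) -cE; apply: submodB; exact: valP.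
move=> q; have [p <-] := abproj_surj q; rewrite -[p](projK (S := perp W)).
have [u [c [Bc ->]]] := metab_split (repr p); exists u.
apply/abproj_eq; rewrite raddfD opprD addrA subrr add0r.
by apply: submodN; exact: lproj_mem_lcs.
Qed.

Lemma gW_proj_ad_iter (us : seq (Metab U)) x :
  gW_proj W (ad_iter us x) = ad_iter (map (gW_proj W) us) (gW_proj W x).
Proof. by elim: us x => [//|u us IH] x /=; rewrite IH gW_proj_lie. Qed.

Definition gW_gen (u : U) : gW W := gW_proj W (metab_gen u).

Lemma gW_proj_cover r (us : r.-tuple U) v w :
  gW_proj W (val (B_cover (tens (sym_prod us) (wedge v w))))
  = ad_iter (map gW_gen us) (lie (gW_gen v) (gW_gen w)).
Proof.
rewrite B_cover_prod val_act_prod gW_proj_ad_iter -map_comp.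
by congr ad_iter; exact: gW_proj_lie.
Qed.

Fact gW_cover_lcs r (x : tensor (Symr U r) (ext2 U)) :
  gW_proj W (val (B_cover x)) \in ideal_space (lcs (gW W) r.+2).
Proof.
pose f : {linear _ -> gW W} := gW_proj W \o (\val \o @B_cover K U r).
apply/(preim_submodP f); apply: symr_ext2_ind => us v w; apply/preim_submodP.
have -> : f (tens (sym_prod us) (wedge v w)) = _ := gW_proj_cover us v w.
exact: (ad_iter_lcs (map_tuple gW_gen us)).
Qed.

(** Values are kept in gamma_(r+2) rather than in its graded quotient, since the terminal tensor
    takes values in gamma_(d+2) itself. *)
Definition gW_cover r (x : tensor (Symr U r) (ext2 U)) :
  subspace (lcs (gW W) r.+2) := insubspace (gW_cover_lcs x).

Fact gW_cover_linear r : linear (@gW_cover r).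
Proof. by move=> a x y; apply: val_inj; rewrite /= !linearP. Qed.
HB.instance Definition _ r := GRing.isLinear.Build K
  (tensor (Symr U r) (ext2 U)) (subspace (lcs (gW W) r.+2)) *:%R (@gW_cover r)
  (@gW_cover_linear r).

Lemma gr_proj_cover r (us : r.-tuple U) v w :
  gr_proj (gW_cover (tens (sym_prod us) (wedge v w)))
  = lc_value (map_tuple gW_gen us) (gW_gen v) (gW_gen w).
Proof. by congr gr_proj; apply: val_inj; exact: gW_proj_cover. Qed.

Lemma transport_prod r (us : r.-tuple U) v w :
  transport W (tens (sym_prod us) (wedge v w)) =
  tens (sym_prod (map_tuple (@abproj K (gW W)) (map_tuple gW_gen us)))
       (wedge (abproj (gW_gen v)) (abproj (gW_gen w))).
Proof.
rewrite /transport tensor_map_prod.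
by congr (tens (sym_prod _) _); apply: val_inj; rewrite /= -map_comp.
Qed.

Lemma lc_tensor_transport r (T : {linear lc_source (gW W) r -> _}) :
  is_lc_tensor T -> forall x, T (transport W x) = gr_proj (gW_cover x).
Proof.
move=> hT.
pose f : {linear tensor (Symr U r) (ext2 U) -> lcs_gr (gW W) r.+2} :=
  T \o @transport K U W r.
pose g : {linear tensor (Symr U r) (ext2 U) -> lcs_gr (gW W) r.+2} :=
  @gr_proj K (gW W) r.+2 \o @gW_cover r.
apply: (symr_ext2_eq (f := f) (g := g)) => us v w.
rewrite -[LHS]/(T (transport W _)) transport_prod hT.
by rewrite -gr_proj_cover.
Qed.

(** The cover is precomposed with the inverse of [theta]. This replaces each entry by a generator
    with the same class in the abelianization, so [lc_value_abproj] gives the prescribed value. *)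
Lemma lc_tensor_exists r :
  exists T : {linear lc_source (gW W) r -> subspace (lcs (gW W) r.+2)},
    is_lc_tensor (@gr_proj K (gW W) r.+2 \o T).
Proof.
have [h [thetaK hK]] := linear_inverse theta_bijective.
pose t : {linear lc_source (gW W) r -> tensor (Symr U r) (ext2 U)} :=
  tensor_map (symr_map h (r := r)) (ext2_map h).
exists (@gW_cover r \o t) => us v w.
transitivity (gr_proj (gW_cover
    (tens (sym_prod (map_tuple h (map_tuple (@abproj K (gW W)) us)))
          (wedge (h (abproj v)) (h (abproj w)))))).
  by congr (gr_proj (gW_cover _)); exact: tensor_map_prod.
rewrite gr_proj_cover.
apply: (lc_value_abproj gW_metabelian); try exact: hK.
by apply: val_inj; rewrite /= -!map_comp; apply: eq_map => u; exact: hK.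
Qed.

Lemma embed_degree_part r Phi : Phi \in gsub_space W ->
  exists2 Psi, degree_part W r Psi & embed r Psi = embed r Phi.
Proof.
move=> /gsub_graded [n [Psi [hPsi ->]]].
have deg0 : degree_part W r 0 by split; exact: rpred0.
have embed_sum : embed r (\sum_(i < n) Psi i) = \sum_(i < n) embed r (Psi i).
  by apply/funext => x; rewrite /embed /= !fct_sumE.
have [rn|nr] := ltnP r n.
  exists (Psi r); first exact: hPsi.
  rewrite embed_sum (bigD1 (Ordinal rn)) //= big1 ?addr0 // => i ir.
  exact: embed_deg0 (hPsi i).2 ir.
(* The decomposition stops before degree [r], so the component there is zero. *)
exists 0 => //; rewrite embed_sum big1 // => i _.
by apply: embed_deg0 (hPsi i).2 _; rewrite ltn_eqF // (leq_trans (ltn_ord i)).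
Qed.

(* [Phi] kills [perp W], so it descends to [gW W]; having degree [r], it also
   kills [gamma_(r+3)], whose lifts lie in degrees greater than [r]. *)
Lemma embed_mem_im_transpose r (T : {linear lc_source (gW W) r -> _}) Phi :
  is_lc_tensor T -> degree_part W r Phi -> im_transpose T (embed r Phi).
Proof.
move=> hT [WPhi /submod_ofP [lin_Phi Phi0]].
have lift (q : subspace (lcs (gW W) r.+2)) :
    exists b : Bmod U, b \in B_ge U r /\ gW_proj W (val b) = val q.
  by have [b] := lcs_gW_lift (valP q); exists b.
have [s sP] := choice lift.
have [f fE] := linear_pack lin_Phi.
have PhiE b b' : gW_proj W (val b) = gW_proj W (val b') -> Phi b = Phi b'.
  move=> bb'; apply/eqP; rewrite -subr_eq0 -fE -linearB fE; apply/eqP.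
  have : gW_proj W (val (b - b')) = 0 by rewrite /= linearB /= bb' subrr.
  by move=> /gW_proj_val_eq0; apply.
(* The lift is arbitrary; by [PhiE] the value depends only on the class in [gW W], whence
   linearity. *)
pose l0 q := Phi (s q).
have lin_l0 : linear l0.
  move=> a x y; rewrite /l0 -lin_Phi; apply: PhiE.
  by rewrite (sP _).2 /= linearP /= !(sP _).2.
have l00 x :
    x \in preim_submod (\val : {linear subspace (lcs (gW W) r.+2) -> gW W})
            (lcs (gW W) r.+3) -> l0 x = 0.
  move=> /preim_submodP /lcs_gW_lift [b Bb bE].
  have -> : l0 x = Phi b by apply: PhiE; rewrite bE (sP x).2.
  apply: (form_B_ge lin_Phi) Bb => i ri; apply: Phi0.
  by rewrite gtn_eqF.
have [l lE] := linear_pack (quotient_lift_linear lin_l0 l00).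
exists l; apply/funext => x; rewrite /= lc_tensor_transport // lE.
rewrite [RHS](quotient_liftE _ lin_l0 l00).
by apply: PhiE; rewrite (sP _).2.
Qed.

Lemma im_transpose_lc_tensor r (T : {linear lc_source (gW W) r -> _}) :
  finite_dim W -> is_lc_tensor T ->
  im_transpose T = [set embed r Phi | Phi in degree_part W r].
Proof.
move=> [s WE] hT; apply/seteqP; split=> [_ [l ->]|_ [Phi WPhi <-]]; last first.
  exact: embed_mem_im_transpose.
have sW Phi : Phi \in s -> Phi \in gsub_space W.
  by move=> hs; rewrite WE; exact: mem_span.
have embed_lin Phi : linear Phi -> linear (embed r Phi).
  move=> lin_Phi a x y; rewrite /embed /= linearP; exact: lin_Phi.
pose F : tensor (Symr U r) (ext2 U) -> K^o := l \o T \o @transport K U W r.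
have : F \in Defs.span [set f | f \in map (embed r) s].
  apply: linear_form_span => [_ /mapP [Phi /sW WPhi ->]| |x sx].
  - exact/embed_lin/W_linear.
  - exact: (linearP (l \o (T \o @transport K U W r))).
  - rewrite /F /= lc_tensor_transport //.
    (* If every [embed r Phi] with [Phi] in [s] kills [x], then all of [W] kills [B_cover x], so its
       class in [gW W] is zero. *)
    suff -> : gW_cover x = 0.
      exact: (linear0 (l \o @gr_proj K (gW W) r.+2)).
    apply/val_inj/gW_proj_val_eq0 => Phi; rewrite WE => hPhi.
    have sub : is_submod [set Psi : Bmod U -> K^o | Psi (B_cover x) = 0].
      split=> //= [f g fx gx|a f fx].
        by rewrite fctE fx gx addr0.
      by rewrite fctE fx scaler0.
    apply/(submod_ofP sub); apply: (span_min _ hPhi) => Psi sPsi.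
    by apply/submod_ofP/(sx (embed r Psi)); exact: map_f.
have sub : is_submod [set G | exists2 Phi, Phi \in gsub_space W
    & embed r Phi = G].
  split=> [|_ _ [f Wf <-] [g Wg <-]|a _ [f Wf <-]].
  - by exists 0; rewrite ?rpred0.
  - by exists (f + g); rewrite ?rpredD.
  - by exists (a *: f); rewrite ?rpredZ.
move=> hF; have : F \in submod_of sub.
  apply: (span_min _ hF) => _ /mapP [Phi sPhi ->]; apply/submod_ofP.
  by exists Phi => //; exact: sW.
move=> /submod_ofP [Phi WPhi FE].
by have [Psi WPsi PsiE] := embed_degree_part r WPhi; exists Psi; rewrite ?PsiE.
Qed.

End QuotientAlgebra.

(** * Recovery of [W], and its top degree *)

Section Recovery.
Variables (K : fieldType) (U : lmodType K) (W : gradedSubmodule U).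
Hypothesis W_fin : finite_dim W.

(** Each of the finitely many spanning forms has a degree bound; the maximum serves the whole span,
    since vanishing at a fixed [b] is a linear condition. *)
Lemma Z2_degree_bound (V : submodClosed (Bmod U -> K^o))
    (s : seq (Bmod U -> K^o)) :
  V =i Defs.span [set x | x \in s] -> {subset V <= Z2 U} ->
  exists N, forall Phi, Phi \in V ->
    forall r, (N <= r)%N -> forall b, b \in B_deg U r -> Phi b = 0.
Proof.
move=> VE VZ.
have : forall Phi, Phi \in s -> Phi \in Z2 U.
  by move=> Phi sPhi; apply: VZ; rewrite VE; exact: mem_span.
move=> sZ.
have [N hN] : exists N, forall Phi, Phi \in s ->
    forall r, (N <= r)%N -> forall b, b \in B_deg U r -> Phi b = 0.
  elim: s sZ {VE} => [|Phi s IH] sZ; first by exists 0%N.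
  have [N hN] := IH (fun Psi h => sZ Psi (mem_behead (s := Phi :: s) h)).
  have /submod_ofP [_ [M hM]] := sZ Phi (mem_head _ _).
  exists (maxn M N) => Psi; rewrite inE => /orP[/eqP -> | sPsi] r;
    rewrite geq_max => /andP[Mr Nr] b Bb; first exact: (hM r).
  exact: (hN _ sPsi r).
exists N => Phi; rewrite VE => hPhi r Nr b Bb.
have sub : is_submod [set Psi : Bmod U -> K^o | Psi b = 0].
  split=> //= [f g fx gx|a f fx]; first by rewrite fctE fx gx addr0.
  by rewrite fctE fx scaler0.
apply/(submod_ofP sub); apply: (span_min _ hPhi) => Psi sPsi.
by apply/submod_ofP; exact: (hN _ sPsi r).
Qed.

(** [Phi] is the sum of the [Psi r] for [r < N], where [N] bounds its degrees: in degree [r] only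
    [Psi r] contributes, and from [N] on both sides embed to zero. *)
Lemma embed_recovers (Phi : Bmod U -> K^o) : Phi \in Z2 U ->
  (forall r, exists2 Psi, degree_part W r Psi & embed r Psi = embed r Phi) ->
  Phi \in gsub_space W.
Proof.
move=> /submod_ofP [lin_Phi [N PhiN]] h.
have comp r : exists Psi, degree_part W r Psi /\ embed r Psi = embed r Phi.
  by have [Psi] := h r; exists Psi.
have [Psi hPsi] := choice comp.
have WS : \sum_(i < N) Psi i \in gsub_space W.
  by apply: rpred_sum => i _; case: (hPsi i) => -[].
suff -> : Phi = \sum_(i < N) Psi i by [].
apply: embed_inj => //; first by have /gsub_Z2 /submod_ofP [] := WS.
move=> r.
have -> : embed r (\sum_(i < N) Psi i) = \sum_(i < N) embed r (Psi i).
  by apply/funext => x; rewrite /embed /= !fct_sumE.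
have [rN|Nr] := ltnP r N.
  rewrite (bigD1 (Ordinal rN)) //= big1 ?addr0 => [|i ir].
    by rewrite (hPsi r).2.
  exact: embed_deg0 (hPsi i).1.2 ir.
rewrite big1 => [|i _].
  by apply/funext => x; exact/(PhiN r)/B_cover_deg.
apply: embed_deg0 (hPsi i).1.2 _.
by rewrite ltn_eqF // (leq_trans (ltn_ord i)).
Qed.

Lemma top_degree_exists : (exists2 Phi, Phi \in gsub_space W & Phi != 0) ->
  exists d, is_top_degree W d.
Proof.
move=> [Phi WPhi Phi0]; have [s sE] := W_fin.
have [N hN] := Z2_degree_bound sE (@gsub_Z2 _ _ W).
pose P r := `[< exists2 Psi, degree_part W r Psi & Psi != 0 >].
(* A form of degree [r > N] vanishes in degree [r] by the bound and in all other degrees by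
   homogeneity. *)
have Pbound r : P r -> (r <= N)%N.
  move=> /asboolP [Psi [WPsi ZPsi] Psi0]; rewrite leqNgt; apply/negP => Nr.
  move/eqP: Psi0; apply; have /submod_ofP [lin_Psi Psi_r] := ZPsi.
  apply/funext => b; apply: (form_B_ge lin_Psi) (B_ge0 b) => t _ c Bc.
  have [tr|tr] := eqVneq t r; last exact: Psi_r tr _ Bc.
  by apply: (hN _ WPsi r (ltnW Nr)); rewrite -tr.
(* A nonzero form of [W] has a nonzero homogeneous component. *)
have exP : exists r, P r.
  have [n [Psi [hPsi PhiE]]] := gsub_graded WPhi.
  apply: contra_neqP Phi0 => noP; rewrite PhiE big1 // => i _.
  apply: contra_notP noP => /eqP Psi0; exists i; apply/asboolP.
  by exists (Psi i).
have [d /asboolP Pd dmax] := ex_maxnP exP Pbound.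
by exists d; split=> // r Pr; apply: dmax; exact/asboolP.
Qed.

(** Elements of gamma_(d+3) lift to degrees greater than [d], where every homogeneous component of a
    form of [W] vanishes; so the lift lies in [perp W]. *)
Lemma lcs_top_degree d x : is_top_degree W d ->
  x \in ideal_space (lcs (gW W) d.+3) -> x = 0.
Proof.
move=> [_ dmax] /lcs_gW_lift [b Bb <-]; apply/gW_proj_val_eq0 => Phi.
move=> /gsub_graded [n [Psi [hPsi ->]]]; rewrite fct_sumE big1 // => i _.
have [/submod_ofP [lin_Psi Psi0]] := (hPsi i).2.
have [->//|Psi_neq0] := eqVneq (Psi i) 0.
apply: (form_B_ge lin_Psi) Bb => r dr; apply: Psi0.
by rewrite gtn_eqF // (leq_ltn_trans _ dr) // dmax //; exists (Psi i).
Qed.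

End Recovery.

Theorem proposition3p3 (K : fieldType) (K_char0 : [pchar K] =i pred0)
    (U : vectType K) (W : gradedSubmodule U) (W_fin : finite_dim W) :
  [/\ (* V is identified with U *)
      bijective (theta W),
      (* the lower central tensors are well defined and symmetric *)
      forall r : nat,
        [/\ forall (us us' : r.-tuple (gW W)) (v v' w w' : gW W),
              map_tuple (@abproj K (gW W)) us
                = map_tuple (@abproj K (gW W)) us' ->
              abproj v = abproj v' -> abproj w = abproj w' ->
              lc_value us v w = lc_value us' v' w',
            forall (us us' : r.-tuple (gW W)) (v w : gW W),
              perm_eq us us' -> lc_value us v w = lc_value us' v w
          & exists T : {linear lc_source (gW W) r -> lcs_gr (gW W) r.+2},
              is_lc_tensor T /\
              forall T' : {linear lc_source (gW W) r -> lcs_gr (gW W) r.+2},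
                is_lc_tensor T' -> T' =1 T],
      (* the image of the transpose of T^(r) is W_r *)
      forall (r : nat)
             (T : {linear lc_source (gW W) r -> lcs_gr (gW W) r.+2}),
        is_lc_tensor T ->
        im_transpose T = [set embed r Phi | Phi in degree_part W r],
      (* the tensors recover W *)
      forall T : (forall r, {linear lc_source (gW W) r -> lcs_gr (gW W) r.+2}),
        (forall r, is_lc_tensor (T r)) ->
        forall Phi : Bmod U -> K^o,
          Phi \in gsub_space W <->
          Phi \in Z2 U /\ forall r, im_transpose (T r) (embed r Phi)
    & (* the terminal tensor *)
      (exists2 Phi, Phi \in gsub_space W & Phi != 0) ->
      exists2 d : nat, is_top_degree W d &
        (forall x, x \in ideal_space (lcs (gW W) d.+3) -> x = 0) /\
        exists T : {linear lc_source (gW W) d ->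
                           subspace (lcs (gW W) d.+2)},
          [/\ is_lc_tensor (@gr_proj K (gW W) d.+2 \o T),
              forall T' : {linear lc_source (gW W) d ->
                                  subspace (lcs (gW W) d.+2)},
                is_lc_tensor (@gr_proj K (gW W) d.+2 \o T') -> T' =1 T
            & im_transpose T = [set embed d Phi | Phi in degree_part W d]]].

Proof.
have im r T := @im_transpose_lc_tensor K U W r T W_fin.
have tensor_ex r : exists T : {linear lc_source (gW W) r -> lcs_gr (gW W) r.+2},
    is_lc_tensor T.
  have [T hT] := lc_tensor_exists W r.
  by exists (@gr_proj K (gW W) r.+2 \o T).
split=> [|r|r T hT|T hT Phi|W_neq0].
- exact: theta_bijective.
- split=> [us us' v v' w w'|us us' v w|].
  + exact/lc_value_abproj/gW_metabelian.
  + exact/lc_value_perm/gW_metabelian.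
  + have [T hT] := tensor_ex r; exists T; split=> // T'.
    exact: is_lc_tensor_uniq.
- exact: im.
- split=> [WPhi|[ZPhi hPhi]].
    split=> [|r]; first exact: gsub_Z2 WPhi.
    rewrite im //; have [Psi WPsi PsiE] := embed_degree_part r WPhi.
    by exists Psi.
  by apply: embed_recovers => // r; have := hPhi r; rewrite im.
- have [d top_d] := top_degree_exists W_fin W_neq0; exists d => //.
  have lcs0 x := lcs_top_degree top_d (x := x); split=> //.
  have [T hT] := lc_tensor_exists W d; exists T; split=> //.
    (* As gamma_(d+3) is zero, [gr_proj] is injective, so uniqueness in the graded quotient gives
       uniqueness in gamma_(d+2). *)
    move=> T' hT' x; apply: (gr_proj_inj lcs0).
    exact: (is_lc_tensor_uniq hT hT').
  rewrite -(im d _ hT); apply/seteqP; split=> _ [l ->]; last first.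
    by exists (l \o @gr_proj K (gW W) d.+2).
  (* For the same reason every form [l] on gamma_(d+2) descends to the graded quotient. *)
  have l0 x : x \in preim_submod
      (\val : {linear subspace (lcs (gW W) d.+2) -> gW W})
      (lcs (gW W) d.+3) -> l x = 0.
    move=> /preim_submodP /lcs0 x0.
    have -> : x = 0 by exact: val_inj.
    exact: linear0.
  have [m mE] := linear_pack (quotient_lift_linear (linearP l) l0).
  exists m; apply/funext => x; rewrite /= mE.
  by rewrite [RHS](quotient_liftE _ (linearP l) l0).
Qed.
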